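(* Let $\Gamma$ be the Dynkin diagram $A_n$, let $\zeta=(\xi,0)\in\mathbb Z^n\times\mathbb C^n$ with $\xi_i>0$ and $\xi_{n+1-i}=\xi_i$ for all $i$, let $\mathbf w_i=0$ for $i\ge2$ and $\mathbf w_1\ge\mathbf v_1\ge\mathbf v_2\ge\dots\ge\mathbf v_n\geq 0$, and let $W=W_1$ be a vector space of dimension $\mathbf w_1$ with a nondegenerate bilinear form. Under Nakajima's isomorphisms $\phi:\mathfrak M_\zeta(\mathbf v,\mathbf w)\cong T^*\mathscr F_{\mathbf v,\mathbf w}$ and $\phi:\mathfrak M_\zeta(w_0*\mathbf v,\mathbf w)\cong T^*\mathscr F_{w_0*\mathbf v,\mathbf w}$, the isomorphism $\sigma=S_{w_0}\tau_\zeta:\mathfrak M_\zeta(\mathbf v,\mathbf w)\to\mathfrak M_\zeta(w_0*\mathbf v,\mathbf w)$, with $w_0$ the longest Weyl group element, is identified with $\sigma_1:T^*\mathscr F_{\mathbf v,\mathbf w}\to T^*\mathscr F_{w_0*\mathbf v,\mathbf w}$, $(x,F)\mapsto(-x^*,F^\perp)$; that is, $\phi\circ\sigma=\sigma_1\circ\phi$. In particular, if $w_0*\mathbf v=\mathbf v$ (i.e. $\mathbf v_i+\mathbf v_{n+1-i}=\mathbf w_1$ for all $i$), then $\phi$ identifies $\mathfrak S_\zeta(\mathbf v,\mathbf w)=\mathfrak M_\zeta(\mathbf v,\mathbf w)^\sigma$ with $$T^*\mathscr F^{\sigma_1}_{\mathbf v,\mathbf w}=\{(x,F)\in\mathfrak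 g(W)\times\mathscr F^{\sigma_1}_{\mathbf v,\mathbf w}: xF_i\subseteq F_{i+1}\ \ \forall\,0\le i\le n\}.$$
   Context: **Flags.** $\mathscr F_{\mathbf v,\mathbf w}$ is the variety of flags $F=(W=F_0\supseteq F_1\supseteq\dots\supseteq F_n\supseteq F_{n+1}=0)$ with $\dim F_i=\mathbf v_i$ for $1\le i\le n$; $T^*\mathscr F_{\mathbf v,\mathbf w}=\{(x,F)\in\operatorname{End}(W)\times\mathscr F_{\mathbf v,\mathbf w}:xF_i\subseteq F_{i+1},\ 0\le i\le n\}$. The right adjoint $T^*$ of a linear map $T$ between spaces with nondegenerate bilinear forms is defined by $(Te,e')=(e,T^*e')$. $F^\perp=(F_{n+1}^\perp\supseteq F_n^\perp\supseteq\cdots\supseteq F_0^\perp)$ with $F_i^\perp=\{u\in W:(F_i,u)=0\}$. $\mathfrak g(W)=\{x\in\operatorname{End}(W):x=-x^*\}$; $\mathscr F^{\sigma_1}_{\mathbf v,\mathbf w}$ is the set of flags with $F=F^\perp$. **Nakajima varieties.** For $A_n$ the arrows are $i\to i+1$ and $i+1\to i$. For graded spaces $V,W$ of dimensions $\mathbf v,\mathbf w$ a point $\mathbf x=(x_i,y_i,p_i,q_i)$ consists of $x_i:V_i\to V_{i+1}$, $y_i:V_{i+1}\to V_i$, $p_i:W_i\to V_i$, $q_i:V_i\to W_i$. $\Lambda(V,W)$ is the set of points with $\mu_i(\mathbf x):=y_ix_i-x_{i-1}y_{i-1}-p_iq_i=0$ for all $i$ (orientation sign $\varepsilon(i+1\to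 i)=1$, $\varepsilon(i\to i+1)=-1$). $G_{\mathbf v}=\prod GL(V_i)$ acts by conjugation. $\mathbf x$ is $\xi$-semistable if (S1) every graded subspace $S\subseteq V$ stable under all $x_i,y_i$ with $S\subseteq\ker q$ has $\xi\cdot\dim S\le0$, and (S2) every stable $T\supseteq\operatorname{im}p$ has $\xi\cdot\dim T\le\xi\cdot\mathbf v$. For $\zeta=(\xi,0)$, $\mathfrak M_\zeta(\mathbf v,\mathbf w)$ is the quotient of the $\xi$-semistable locus of $\Lambda(V,W)$ by $G_{\mathbf v}$ (a free quotient when all $\xi_i>0$ or $\xi$ is a Weyl translate of such). **Nakajima's isomorphism.** $\phi([\mathbf x])=(q_1p_1,\ W\supseteq\operatorname{im}q_1\supseteq\operatorname{im}q_1y_1\supseteq\cdots\supseteq\operatorname{im}q_1y_1\cdots y_{n-1}\supseteq0)$. **Reflection functors.** With Cartan matrix $(c_{ij})$: $s_i(\xi)_j=\xi_j-c_{ji}\xi_i$; $(s_i*\mathbf v)_i=\mathbf v_i-\sum_jc_{ij}\mathbf v_j+\mathbf w_i$, $(s_i*\mathbf v)_j=\mathbf v_j$ for $j\ne i$; these extend to Weyl group actions, and $w_0*\mathbf v=(\mathbf w_1-\mathbf v_n,\dots,\mathbf w_1-\mathbf v_1)$. Put $U_i=W_i\oplus\bigoplus_{h:i\to j}V_j$, $a_i(\mathbf x)=(q_i,x_h)_{h\text{ out of }i}:V_i\to U_i$, $b_i(\mathbf x)=(p_i,\varepsilon(\bar h)x_h)_{h\text{ into }i}:U_i\to V_i$,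 where $x_h$ is the component along arrow $h$ and $\bar h$ is the reversed arrow. If $\xi_i<0$, $S_i:\mathfrak M_\zeta(\mathbf v,\mathbf w)\to\mathfrak M_{s_i\zeta}(s_i*\mathbf v,\mathbf w)$ sends $[\mathbf x]$ to $[\mathbf x']$, where $V_j'=V_j$ for $j\ne i$, all components not touching vertex $i$ agree, $0\to V_i'\xrightarrow{a_i(\mathbf x')}U_i\xrightarrow{b_i(\mathbf x)}V_i\to0$ is exact, $a_i(\mathbf x)b_i(\mathbf x)=a_i(\mathbf x')b_i(\mathbf x')$ and $\mu_j(\mathbf x)=\mu_j(\mathbf x')=0$ for $j\ne i$. If $\xi_i>0$, $S_i$ is the inverse of this map for $s_i\zeta$. $S_{w_0}$ is the composition along a reduced word. **Transpose.** $\tau_\zeta:\mathfrak M_\zeta(\mathbf v,\mathbf w)\to\mathfrak M_{-\zeta}(\mathbf v,\mathbf w)$ is induced by $x_i\mapsto-y_i^*$, $y_i\mapsto x_i^*$, $p_i\mapsto-q_i^*$, $q_i\mapsto p_i^*$, adjoints taken with respect to the form on $W$ and arbitrary nondegenerate forms on the $V_i$ (independent of the latter). *)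

(* Defs.v *)
From HB Require Import structures.
From mathcomp Require Import all_boot all_order all_algebra.
From mathcomp Require Import sesquilinear complex.
From mathcomp Require Import boolp classical_sets functions reals.

Set Implicit Arguments.
Unset Strict Implicit.
Unset Printing Implicit Defensive.

Import Order.TTheory GRing.Theory Num.Theory.
Local Open Scope ring_scope.

(* The vertices of A_n are the natural numbers 1, ..., n.  Families over the
   vertices are indexed by nat; values of weights and dimension vectors outside
   1, ..., n are irrelevant, and the spaces V_i vanish outside 1, ..., n (see
   [dim_is]), so that all maps into or out of V_0 or V_{n+1} are zero. *)
Definition vert (n i : nat) : bool := (0 < i <= n)%N.

Section WeylGroup.
Implicit Types (i j : nat) (s t : seq nat) (xi v : nat -> int).

Definition cartan i j : int :=
  if i == j then 2 else if (i == j.+1) || (j == i.+1) then -1 else 0.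

Definition srefl i xi : nat -> int := fun j => xi j - cartan j i * xi i.

Definition star n (w : nat -> nat) i v : nat -> int :=
  fun j => if j == i
    then v i - \sum_(1 <= k < n.+1) cartan i k * v k + (w i)%:Z
    else v j.

(* The word [:: i_1; ...; i_N] stands for s_{i_1} ... s_{i_N}, so the last letter
   acts first. *)
Definition weyl s xi : nat -> int := foldr srefl xi s.
Definition wstar n w s v : nat -> int := foldr (star n w) v s.

(* The Weyl group is realized faithfully on the weights Z^n. *)
Definition same_weyl n s t : Prop :=
  forall xi j, vert n j -> weyl s xi j = weyl t xi j.

Definition reduced_word n s : Prop :=
  all (vert n) s /\
  forall t, all (vert n) t -> same_weyl n t s -> (size s <= size t)%N.

(* the reduced words of the element w_0 of maximal length *)
Definition longest_word n s : Prop :=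
  reduced_word n s /\ forall t, reduced_word n t -> (size t <= size s)%N.

End WeylGroup.

Section LinearAlgebra.
Variable C : fieldType.
Implicit Types U V : vectType C.

Definition lbij U V (f : 'Hom(U, V)) : Prop := lker f = 0%VS /\ limg f = fullv.

Definition nondeg V (B : {biscalar V}) : Prop :=
  (forall u, (forall v, B u v = 0) -> u = 0) /\
  (forall v, (forall u, B u v = 0) -> v = 0).

(* By [radjP], the default value 0 is never used when BU is nondegenerate. *)
Definition radj U V (BU : {biscalar U}) (BV : {biscalar V}) (f : 'Hom(U, V)) :
    'Hom(V, U) :=
  xget 0 [set g : 'Hom(V, U) | forall e e', BV (f e) e' = BU e (g e')]%classic.

(* {u | (S, u) = 0}, as shown by [memv_perp] *)
Definition perp V (B : {biscalar V}) (S : {vspace V}) : {vspace V} :=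
  (\bigcap_(k < \dim S) lker (linfun (B (vbasis S)`_k : V -> C^o)))%VS.

Lemma linfun_linE U V (f : U -> V) : linear f -> linfun f =1 f.
Proof.
move=> lf x.
pose F : {linear U -> V} := HB.pack f (GRing.isLinear.Build _ _ _ _ _ lf).
exact: (lfunE F).
Qed.

Lemma linfunB V (B : {biscalar V}) u v : linfun (B u : V -> C^o) v = B u v.
Proof. by apply: linfun_linE => a x y; rewrite linearPr. Qed.

Lemma memv_perp V (B : {biscalar V}) (S : {vspace V}) u :
  (u \in perp B S) <-> (forall e, e \in S -> B e u = 0).
Proof.
have Bk (k : 'I_(\dim S)) : (u \in lker (linfun (B (vbasis S)`_k : V -> C^o)))
    = (B (vbasis S)`_k u == 0) by rewrite memv_ker linfunB.
split=> [uS e eS | uS].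
  rewrite (coord_vbasis eS) linear_sumlz big1 // => k _.
  rewrite linearZl_LR; apply/eqP; rewrite mulf_eq0 -Bk; apply/orP; right.
  by move: u uS {Bk}; apply/subvP; apply: (@bigcapv_inf _ _ _ k).
rewrite memvE; apply/subv_bigcapP => k _; rewrite -memvE Bk; apply/eqP/uS.
by apply: vbasis_mem; rewrite mem_nth // size_tuple.
Qed.

Lemma radjP U V (BU : {biscalar U}) (BV : {biscalar V}) (f : 'Hom(U, V)) :
  nondeg BU -> forall e e', BV (f e) e' = BU e (radj BU BV f e').
Proof.
case=> _ nBU.
set d := \dim {:U}; pose b k := (vbasis {:U})`_k.
pose G : 'Hom(U, 'rV[C]_d) := linfun (fun v => \row_(k < d) BU (b k) v).
pose H : 'Hom(V, 'rV[C]_d) := linfun (fun v => \row_(k < d) BV (f (b k)) v).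
have GE v : G v = \row_(k < d) BU (b k) v.
  apply: linfun_linE => a x y; apply/rowP => k.
  by rewrite !mxE linearPr.
have HE v : H v = \row_(k < d) BV (f (b k)) v.
  apply: linfun_linE => a x y; apply/rowP => k.
  by rewrite !mxE linearPr.
have ext e : e = \sum_(k < d) coord (vbasis {:U}) k e *: b k.
  by rewrite [LHS](coord_vbasis (memvf e)).
have G0 : lker G == 0%VS.
  apply/lker0P => x y; rewrite !GE => Exy; apply/eqP.
  rewrite -subr_eq0; apply/eqP/nBU => e.
  rewrite [e]ext linear_sumlz big1 // => k _.
  rewrite linearZl_LR linearBr /=; move/rowP: Exy => /(_ k); rewrite !mxE => ->.
  by rewrite subrr mulr0.
have Gf : limg G = fullv.
  apply/eqP; rewrite eqEdim subvf /= limg_dim_eq; last first.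
    by rewrite (eqP G0) capv0.
  by rewrite dimvf dim_matrix mul1r.
have HG y : G ((G^-1)%VF y) = y.
  by apply: limg_lfunVK; rewrite Gf memvf.
rewrite /radj; case: xgetP => [g _ //|/(_ (G^-1 \o H)%VF)[]] e e'.
rewrite [e]ext linear_sum !linear_sumlz /=.
apply: eq_bigr => k _; rewrite !linearZ /= !linearZl_LR; congr (_ * _).
by rewrite comp_lfunE; move/rowP: (HG (H e')) => /(_ k); rewrite GE HE !mxE.
Qed.

End LinearAlgebra.

Section Quiver.
Variables (C : fieldType) (W : nat -> vectType C).
Local Open Scope classical_set_scope.

Definition gr (d : nat -> nat) (i : nat) : vectType C := 'rV[C]_(d i).

(* A point (x_i, y_i, p_i, q_i), with V_i the standard space C^{d_i}. *)
Record rep := Rep {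
  dimr : nat -> nat;
  rx : forall i, 'Hom(gr dimr i, gr dimr i.+1);
  ry : forall i, 'Hom(gr dimr i.+1, gr dimr i);
  rp : forall i, 'Hom(W i, gr dimr i);
  rq : forall i, 'Hom(gr dimr i, W i) }.

Local Notation V x i := (gr (dimr x) i).

Implicit Types (x : rep) (X : set rep) (n i k : nat) (xi v : nat -> int).

(* x_{i-1} : V_{i-1} -> V_i and y_{i-1} : V_i -> V_{i-1} *)
Definition rxm x i : 'Hom(V x i.-1, V x i) :=
  match i with 0%N => 0 | k.+1 => rx x k end.
Definition rym x i : 'Hom(V x i, V x i.-1) :=
  match i with 0%N => 0 | k.+1 => ry x k end.

Definition mu x i : 'Hom(V x i, V x i) :=
  (ry x i \o rx x i)%VF - (rxm x i \o rym x i)%VF - (rp x i \o rq x i)%VF.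

Definition dim_is n x v : Prop :=
  forall i, (dimr x i)%:Z = if vert n i then v i else 0.

Definition dotw n xi v : int := \sum_(1 <= i < n.+1) xi i * v i.

Definition stable x (S : forall i, {vspace V x i}) : Prop :=
  forall i, (rx x i @: S i <= S i.+1)%VS /\ (ry x i @: S i.+1 <= S i)%VS.

Definition semistable n xi x : Prop :=
  (forall S : forall i, {vspace V x i}, stable S ->
     (forall i, (S i <= lker (rq x i))%VS) ->
     dotw n xi (fun i => (\dim (S i))%:Z) <= 0) /\
  (forall T : forall i, {vspace V x i}, stable T ->
     (forall i, (limg (rp x i) <= T i)%VS) ->
     dotw n xi (fun i => (\dim (T i))%:Z) <=
     dotw n xi (fun i => (dimr x i)%:Z)).

Definition semistable_locus n xi v : set rep :=
  [set x | [/\ dim_is n x v, forall i, mu x i = 0 & semistable n xi x]].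

(* For points of equal dimension this is the orbit relation of G_v; it forces
   dimr x = dimr x'. *)
Definition same_orbit x x' : Prop :=
  exists g : forall i, 'Hom(V x i, V x' i),
    (forall i, lbij (g i)) /\
    forall i, [/\ rx x' i \o g i = g i.+1 \o rx x i,
                  ry x' i \o g i.+1 = g i \o ry x i,
                  rp x' i = g i \o rp x i &
                  rq x' i \o g i = rq x i]%VF.

Definition Gorbit x : set rep := [set x' | same_orbit x x'].

(* The set of points of M_zeta(v, w) for zeta = (xi, 0) with free G_v-action on
   the semistable locus: the set of G_v-orbits in it. *)
Definition Nakajima n xi v : set (set rep) := Gorbit @` semistable_locus n xi v.

(* U_i = W_i + V_{i-1} + V_{i+1}; the signs in b_i are eps(i -> i-1) = 1 and
   eps(i -> i+1) = -1. *)
Definition U x i : vectType C := (W i * V x i.-1 * V x i.+1)%type.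
Definition ra x i (u : V x i) : U x i := (rq x i u, rym x i u, rx x i u).
Definition rb x i (u : U x i) : V x i :=
  rp x i u.1.1 + rxm x i u.1.2 - ry x i u.2.

(* The relation between x and x' defining S_i when xi_i < 0.  The identifications
   V_j = V_j', j <> i, are given by the isomorphisms g_j. *)
Definition reflection i x x' : Prop :=
  exists g : forall j, 'Hom(V x j, V x' j),
  let gU (u : U x i) : U x' i := (u.1.1, g i.-1 u.1.2, g i.+1 u.2) in
  [/\ forall j, j <> i -> lbij (g j),
      forall j, j <> i -> j.+1 <> i ->
        (rx x' j \o g j)%VF = (g j.+1 \o rx x j)%VF /\
        (ry x' j \o g j.+1)%VF = (g j \o ry x j)%VF,
      forall j, j <> i ->
        rp x' j = (g j \o rp x j)%VF /\ (rq x' j \o g j)%VF = rq x j,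
      [/\ injective (@ra x' i),
          forall u : U x i, rb u = 0 <-> exists u', ra u' = gU u &
          forall u, exists u0 : U x i, rb u0 = u] &
      (forall u : U x i, gU (ra (rb u)) = ra (rb (gU u))) /\
      (forall j, j <> i -> mu x j = 0 /\ mu x' j = 0)].

Let w i : nat := \dim {:W i}.

(* S_i : M_(xi,0)(v) -> M_(s_i xi,0)(s_i * v), as an operation on G-orbits *)
Definition reflS n i xi v X : set rep :=
  [set x' | semistable_locus n (srefl i xi) (star n w i v) x' /\
     exists2 x, X x & xi i < 0 /\ reflection i x x' \/
                      0 < xi i /\ reflection i x' x].

Fixpoint reflS_word n (s : seq nat) xi v X : set rep :=
  if s is i :: s' then
    reflS n i (weyl s' xi) (wstar n w s' v) (reflS_word n s' xi v X)
  else X.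

Section Forms.
Variable B : forall i, {biscalar (W i)}.

Definition transpose x (BV : forall i, {biscalar (V x i)}) : rep :=
  @Rep (dimr x)
    (fun i => - radj (BV i.+1) (BV i) (ry x i))
    (fun i => radj (BV i) (BV i.+1) (rx x i))
    (fun i => - radj (BV i) (B i) (rq x i))
    (fun i => radj (B i) (BV i) (rp x i)).

(* all choices of the forms on V are made at once *)
Definition tau X : set rep :=
  [set x' | exists2 x, X x & exists2 BV : forall i, {biscalar (V x i)},
              (forall i, nondeg (BV i)) & x' = transpose BV].

(* sigma = S_{w_0} tau_zeta, for s a word of w_0 *)
Definition sigma n s xi v X : set rep :=
  reflS_word n s (fun i => - xi i) v (tau X).

End Forms.

Fixpoint ypath x k : 'Hom(V x k.+1, V x 1) :=
  match k with 0%N => \1%VF | k'.+1 => (ypath x k' \o ry x k'.+1)%VF end.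

(* For a point of M(v, w), the last entry of the flag is 0 since V_{n+1} = 0. *)
Definition phi_rep n x : 'End(W 1) * {ffun 'I_n.+2 -> {vspace W 1}} :=
  ((rq x 1 \o rp x 1)%VF,
   [ffun i : 'I_n.+2 =>
      if (i : nat) is k.+1 then limg (rq x 1 \o ypath x k) else fullv]).

Definition phi n X : 'End(W 1) * {ffun 'I_n.+2 -> {vspace W 1}} :=
  xget (0, [ffun=> 0%VS]) (phi_rep n @` X).

Lemma phi_rep_orbit n x x' : same_orbit x x' -> phi_rep n x' = phi_rep n x.
Proof.
case=> g [gb gE].
have yE k : (ypath x' k \o g k.+1)%VF = (g 1%N \o ypath x k)%VF.
  elim: k => [|k IH] /=; first by rewrite comp_lfun1l comp_lfun1r.
  have [_ Ey _ _] := gE k.+1.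
  by rewrite -comp_lfunA Ey comp_lfunA IH comp_lfunA.
have [_ _ Ep Eq] := gE 1%N.
congr pair; first by rewrite Ep comp_lfunA Eq.
apply/ffunP => i; rewrite !ffunE; case: (i : nat) => // k.
have [_ gf] := gb k.+1.
rewrite -[rq x 1]Eq -comp_lfunA -yE !limg_comp gf.
by rewrite -!limg_comp.
Qed.

Lemma phi_Gorbit n x : phi n (Gorbit x) = phi_rep n x.
Proof.
rewrite /phi; case: xgetP => [_ -> [x' xx' <-]|/(_ (phi_rep n x))[]].
  exact: phi_rep_orbit.
exists x => //; exists (fun i => \1%VF); split=> i.
  by split; [apply/eqP/lker0P => a b; rewrite !id_lfunE | rewrite lim1g].
by split; rewrite ?comp_lfun1l ?comp_lfun1r.
Qed.

End Quiver.

Section Flags.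
Variables (C : fieldType) (W : vectType C) (n : nat).
Local Notation flag := {ffun 'I_n.+2 -> {vspace W}}.
Local Open Scope classical_set_scope.
Implicit Types (F : flag) (v : nat -> int).

Definition flagvar v : set flag :=
  [set F | [/\ F ord0 = fullv, F ord_max = 0%VS,
     forall i j : 'I_n.+2, (i <= j)%N -> (F j <= F i)%VS &
     forall i : 'I_n.+2, vert n i -> (\dim (F i))%:Z = v i]].

Definition shifts (x : 'End(W)) F : Prop :=
  forall i j : 'I_n.+2, j = i.+1 :> nat -> (x @: F i <= F j)%VS.

Definition Tflagvar v : set ('End(W) * flag) :=
  [set xF | flagvar v xF.2 /\ shifts xF.1 xF.2].

Variable B : {biscalar W}.

Definition perp_flag F : flag := [ffun i => perp B (F (rev_ord i))].

Definition sigma1 (xF : 'End(W) * flag) : 'End(W) * flag :=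
  (- radj B B xF.1, perp_flag xF.2).

Definition gform : set 'End(W) := [set x | x = - radj B B x].

Definition flagvar_sigma v : set flag :=
  [set F | flagvar v F /\ F = perp_flag F].

Definition Tflagvar_sigma v : set ('End(W) * flag) :=
  [set xF | [/\ gform xF.1, flagvar_sigma v xF.2 & shifts xF.1 xF.2]].

End Flags.

Arguments Nakajima {C} W n xi v.
Arguments Tflagvar {C} W n v.
Arguments Tflagvar_sigma {C W} n B v.

(* Main.v *)
(* Write [V_0 = W] and [x_0 = p_1], [y_0 = q_1]; a point is then a chain
   W <-> V_1 <-> ... <-> V_n with y_k x_k = x_{k-1} y_{k-1}.  For a set [J] of
   edges, let [F_J] be the space of those [u_0 : W] that extend to a sequence
   (u_k) with [u_k = y_k u_{k+1}] for [k] in [J] and [u_{k+1} = x_k u_k] for the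
   other [k].  If [xi_i < 0], the exactness of V_i' -> U_i -> V_i says precisely
   that [S_i] preserves these spaces, up to the exchange of the edges [i-1] and
   [i], whenever [i-1 in J] implies [i in J].  Along a reduced word of [w_0] from
   the chamber of [-xi] to that of [xi] only reflections with [xi_i < 0] occur.
   For [tau x] and J = {n+1-k, ..., n} the space is the kernel of a path, which is
   the orthogonal of the image of the adjoint path, i.e. of F_{n+1-k}; in the
   chamber of [xi] the set [J] has become {0, ..., k-1}, and the space is the k-th
   space of the flag of [sigma x].  As [phi] is injective on orbits in the chamber
   of [xi], the result does not depend on any choice. *)
From HB Require Import structures.
Require Import Defs.
From mathcomp Require Import all_boot all_order all_algebra.
From mathcomp Require Import sesquilinear complex.
From mathcomp Require Import boolp classical_sets functions reals.
From mathcomp Require Import zify.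

Set Implicit Arguments.
Unset Strict Implicit.
Unset Printing Implicit Defensive.

Import Order.TTheory GRing.Theory Num.Theory.
Local Open Scope ring_scope.
Local Open Scope classical_set_scope.

(** * Words in the Weyl group as permutations of 0, ..., n *)

Section Words.
Implicit Types (i j k n p q : nat) (s t : seq nat) (xi v : nat -> int).

(** In the intermediate chambers a point has no description by a flag, and the relation defining
    [S_i] fixes V_i' only up to isomorphism. So a word acts on a set of points, and only data inside
    [W], where nothing is chosen, are carried along it: the endomorphism q_1 p_1 and the spaces F_J.
    The intermediate sets are shown to be nonempty, by constructing a reflected point at each step;
    that the set is a single orbit is proved only at the end of the word, through [phi].

    The condition on [J] excludes one pattern. If i-1 is in [J] and i is not, the triples (u_{i-1},
    u_i, u_{i+1}) describe im a_i(x), and after the exchange they would describe ker b_i(x');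
    exactness relates the other pair, ker b_i(x) and im a_i(x'). The condition persists along the
    word because [J] starts out closed upwards and each letter of a reduced word meets an ascent of
    the permutation built so far. The same ascents, applied to a weight written as theta_{j-1} -
    theta_j with [theta] increasing, make each xi_i negative when its turn comes. *)

Definition transp p q k : nat := if k == p then q else if k == q then p else k.

Lemma transpK p q : involutive (transp p q).
Proof. by rewrite /transp => k; do !case: eqP => //; lia. Qed.

(* The weight [j |-> theta j.-1 - theta j] is moved by the word [s] to the
   weight of [theta \o wperm s]. *)
Definition wperm s : nat -> nat := foldr (fun i f => f \o transp i.-1 i) id s.

Lemma wperm_inj s : injective (wperm s).
Proof.
elim: s => [|i s IHs] //=.
by apply: inj_comp => //; apply: inv_inj; apply: transpK.
Qed.

Lemma wperm_le n s k : all (vert n) s -> (k <= n)%N -> (wperm s k <= n)%N.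
Proof.
elim: s k => [|i s IHs] k //= /andP[/andP[i0 ltin] alls] lekn.
by apply: IHs => //; rewrite /transp; do !case: eqP => //; lia.
Qed.

Lemma weyl_wperm n s xi (theta : nat -> int) : all (vert n) s ->
  (forall j, (0 < j)%N -> xi j = theta j.-1 - theta j) ->
  forall j, (0 < j)%N -> weyl s xi j = theta (wperm s j.-1) - theta (wperm s j).
Proof.
move=> alls xiE; elim: s alls => [|i s IHs] //= /andP[/andP[i0 ltin] alls] j j0.
rewrite /srefl !IHs // /cartan /transp.
case: (eqVneq j i) => [->|neji]; first by rewrite !eqxx; case: eqP => //; lia.
case: (eqVneq j i.+1) => [->|neji1].
  by rewrite eqxx /=; do !case: eqP => //; lia.
case: (eqVneq i j.+1) => [->|neij1] /=.
  by do !case: eqP => //; lia.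
by do !case: eqP => //; try lia; rewrite mul0r subr0.
Qed.

Lemma weight_diff xi :
  exists theta : nat -> int, forall j, (0 < j)%N -> xi j = theta j.-1 - theta j.
Proof.
exists (fun k => - \sum_(1 <= l < k.+1) xi l) => -[|j] // _.
by rewrite [X in _ - - X]big_nat_recr //= opprK addKr.
Qed.

(** Every weight is a difference of some [theta], so lengths of words can be compared through their
    permutations. *)
Lemma same_weyl_wperm n s t : all (vert n) s -> all (vert n) t ->
  wperm s =1 wperm t -> same_weyl n s t.
Proof.
move=> alls allt E xi j /andP[j0 _].
have [theta xiE] := weight_diff xi.
by rewrite (weyl_wperm alls xiE) // (weyl_wperm allt xiE) // !E.
Qed.

Lemma same_weyl_cons n i s t : vert n i -> same_weyl n s t ->
  same_weyl n (i :: s) (i :: t).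
Proof. by move=> vi st xi j vj; rewrite /= /srefl !st. Qed.

(* If the letter [j] is the step of [s] at which the values at the positions
   [p < q] are exchanged, then erasing [j] amounts to composing with the
   transposition of [p] and [q]. *)
Lemma wperm_deletion n s p q : all (vert n) s -> (p < q)%N ->
  (wperm s q < wperm s p)%N ->
  exists t, [/\ all (vert n) t, size s = (size t).+1 &
    forall k, wperm t k = wperm s (transp p q k)].
Proof.
elim: s p q => [|j s IHs] p q /=; first by move=> _; lia.
move=> /andP[/andP[j0 lejn] alls] ltpq ltE.
have [[Ep Eq]|npq] := pselect (p = j.-1 /\ q = j).
  by exists s; split=> // k; rewrite Ep Eq transpK.
(* An exchange of neighbours reverses the order of no other pair, so the induction hypothesis
   applies to the moved pair. *)
have lttr : (transp j.-1 j p < transp j.-1 j q)%N.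
  by move: npq; rewrite /transp; do !case: eqP => //; lia.
have [t [allt sizet tE]] := IHs _ _ alls lttr ltE.
exists (j :: t); split=> //=; first by rewrite allt andbT; apply/andP.
  by rewrite sizet.
move=> k; rewrite tE; congr (wperm s _).
by rewrite /transp; do !case: eqP => //; lia.
Qed.

(** At a descent of [s], erasing a letter of [s] would already give the permutation of [i :: s], by
    a word shorter by two letters. *)
Lemma reduced_ascent n r i s : reduced_word n (r ++ i :: s) ->
  (wperm s i.-1 < wperm s i)%N.
Proof.
case; rewrite all_cat /= => /andP[allr /andP[vi alls]] minrs.
have /andP[i0 lein] := vi.
rewrite ltnNge; apply/negP => le_i.
have lt_i : (wperm s i < wperm s i.-1)%N.
  by rewrite ltn_neqAle le_i andbT; apply/eqP => /wperm_inj; lia.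
have ltii : (i.-1 < i)%N by lia.
have [t [allt sizet tE]] := wperm_deletion alls ltii lt_i.
have /minrs : all (vert n) (r ++ t) by rewrite all_cat allr.
suff st : same_weyl n (r ++ t) (r ++ i :: s).
  by move/(_ st); rewrite !size_cat /= sizet; lia.
apply: same_weyl_wperm; rewrite ?all_cat ?allr //= ?vi //.
by move=> k; rewrite /wperm !foldr_cat; elim: r k {allr minrs} => //= a r ->.
Qed.

(** At an ascent [i] of [s] the word [i :: s] would still be reduced, contradicting maximality. So
    the permutation decreases everywhere. *)
Lemma longest_wperm n s k : longest_word n s -> (k <= n)%N ->
  wperm s k = (n - k)%N.
Proof.
case=> -[alls mins] maxs.
have desc i : vert n i -> (wperm s i < wperm s i.-1)%N.
  move=> vi; have /andP[i0 lein] := vi.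
  rewrite ltnNge; apply/negP => le_i.
  have lt_i : (wperm s i.-1 < wperm s i)%N.
    by rewrite ltn_neqAle le_i andbT; apply/eqP => /wperm_inj; lia.
  suff /maxs : reduced_word n (i :: s) by rewrite ltnn.
  have allis : all (vert n) (i :: s) by apply/andP.
  split=> // t allt ist; rewrite leqNgt; apply/negP.
  rewrite [size (_ :: _)]/= ltnS => lets.
  have ltit : (wperm t i < wperm t i.-1)%N.
    (* The weight with [theta] the identity shows the values of the permutation: the descent of
       [i :: s] at [i] is also one of [t]. Deleting there gives a word for [s] that is too short. *)
    have := ist (fun j => (j.-1)%:Z - j%:Z) i vi.
    have dE j : (0 < j)%N -> (j.-1)%:Z - j%:Z = (j.-1)%:Z - j%:Z :> int by [].
    rewrite (weyl_wperm (theta := Posz) allt dE) //.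
    rewrite (weyl_wperm (theta := Posz) allis dE) //=.
    have -> : transp i.-1 i i.-1 = i by rewrite /transp eqxx.
    have -> : transp i.-1 i i = i.-1.
      by rewrite /transp; do !case: eqP => //; lia.
    lia.
  have ltii : (i.-1 < i)%N by lia.
  have [t' [allt' sizet' tE]] := wperm_deletion allt ltii ltit.
  suff st : same_weyl n t' s by have := mins _ allt' st; lia.
  move=> xi j vj.
  have -> : weyl t' xi j = weyl (i :: t) xi j.
    by apply: (same_weyl_wperm allt' (n := n)) => //; apply/andP.
  rewrite (same_weyl_cons vi ist) //.
  apply: (@same_weyl_wperm n) => //; first by rewrite /= !vi.
  by move=> l /=; rewrite transpK.
move=> lekn.
(* Strict decrease bounds the values from above, starting at 0, and from below, starting at [n]; the
   two bounds meet. *)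
have hi : forall m, (m <= n)%N -> (wperm s m + m <= n)%N.
  elim=> [|m IHm] lemn; first by rewrite addn0 wperm_le.
  have vm : vert n m.+1 by apply/andP.
  by have := desc _ vm; have := IHm (ltnW lemn); rewrite /=; lia.
have lo m : (m <= n)%N -> (m <= wperm s (n - m))%N.
  elim: m => // m IHm lemn.
  have vm : vert n (n - m) by apply/andP; split; lia.
  have := desc _ vm; have := IHm (ltnW lemn).
  by rewrite subnS; lia.
by have := hi k lekn; have := lo (n - k)%N (leq_subr _ _); rewrite subKn //; lia.
Qed.

End Words.

(** * The action on dimension vectors *)

Section DimensionVectors.
Implicit Types (i j k n : nat) (s : seq nat) (xi d v : nat -> int).

Definition ext n d k : int := if vert n k then d k else 0.

Lemma cartan_sum n i d : vert n i ->
  \sum_(1 <= k < n.+1) cartan i k * d k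
    = 2 * d i - ext n d i.-1 - ext n d i.+1.
Proof.
move=> vi; have /andP[i0 _] := vi.
have delta m : \sum_(1 <= k < n.+1) (if k == m then d k else 0) = ext n d m.
  by rewrite -big_mkcond big_nat1_eq.
rewrite (_ : d i = ext n d i); last by rewrite /ext vi.
rewrite -!delta mulr_sumr -!sumrB; apply: eq_bigr => k _.
by rewrite /cartan; do !case: eqP => //=; lia.
Qed.

Lemma starE n (w : nat -> nat) i v : vert n i ->
  star n w i v i = ext n v i.-1 + ext n v i.+1 - v i + (w i)%:Z.
Proof. by move=> vi; rewrite /star eqxx cartan_sum //; lia. Qed.

Lemma dotw_srefl n i xi d : vert n i ->
  dotw n (srefl i xi) d
    = dotw n xi d + xi i * (ext n d i.-1 + ext n d i.+1 - 2 * d i).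
Proof.
move=> vi; rewrite /dotw.
have -> : ext n d i.-1 + ext n d i.+1 - 2 * d i
    = - \sum_(1 <= k < n.+1) cartan i k * d k by rewrite cartan_sum //; lia.
rewrite mulrN mulr_sumr -sumrB; apply: eq_bigr => k _.
rewrite /srefl mulrBl; congr (_ - _).
rewrite [cartan k i](_ : _ = cartan i k); first by rewrite mulrCA mulrA.
by rewrite /cartan eq_sym orbC.
Qed.

Lemma eq_dotw n xi xi' d d' :
  (forall i, vert n i -> xi i = xi' i) -> (forall i, vert n i -> d i = d' i) ->
  dotw n xi d = dotw n xi' d'.
Proof.
by move=> xiE dE; apply: eq_big_nat => i vi; rewrite xiE ?dE.
Qed.

(* [v_0 = w_1] and [v_{n+1} = 0], as for the complete chain of dimensions of a
   flag in [W]. *)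
Definition chain_dim n (w : nat -> nat) v k : int :=
  if k == 0%N then (w 1%N)%:Z else ext n v k.

(** In the chain w_1, v_1, ..., v_n, 0 the operation of s_i replaces an entry by the sum of its
    neighbours minus itself, which exchanges the differences on its two sides. For [i = 1] the
    framing dimension is the left neighbour. *)
Lemma wstar_diff n (w : nat -> nat) s v k :
  (forall i, i <> 1%N -> w i = 0%N) -> all (vert n) s -> (k <= n)%N ->
  chain_dim n w (wstar n w s v) k - chain_dim n w (wstar n w s v) k.+1
    = chain_dim n w v (wperm s k) - chain_dim n w v (wperm s k).+1.
Proof.
move=> w0; elim: s k => [|i s IHs] k //= /andP[vi alls] lekn.
have /andP[i0 lein] := vi.
have stepE j : chain_dim n w (wstar n w (i :: s) v) j =
    if j == i then chain_dim n w (wstar n w s v) i.-1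
      + chain_dim n w (wstar n w s v) i.+1 - chain_dim n w (wstar n w s v) i
    else chain_dim n w (wstar n w s v) j.
  rewrite /chain_dim; case: (eqVneq j i) => [->|neji].
    rewrite (negbTE (lt0n_neq0 i0)) {1}/ext vi /= starE //.
    rewrite [ext n _ i]/ext vi; case: eqP => i1; last first.
      by rewrite w0; lia.
    have -> : i = 1%N by lia.
    by rewrite {1}/ext /=; lia.
  by case: eqP => // _; rewrite /ext /= /star (negbTE neji).
rewrite -!IHs //; last first.
  by rewrite /transp; do !case: eqP => //; lia.
rewrite !stepE /transp; case: (eqVneq k i.-1) => [->|neki].
  have -> : (i.-1 == i) = false by apply/eqP; lia.
  have -> : i.-1.+1 = i by lia.
  by rewrite eqxx; lia.
have -> : (k.+1 == i) = false by apply/eqP; lia.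
case: eqP => [->|neki']; last by [].
have -> : i.-1.+1 = i by lia.
lia.
Qed.

(** The differences of the chain are reversed, and they telescope from the common value w_1 at 0. *)
Lemma wstar_longest n (w : nat -> nat) s v k :
  (forall i, i <> 1%N -> w i = 0%N) -> longest_word n s -> vert n k ->
  wstar n w s v k = (w 1%N)%:Z - v (n.+1 - k)%N.
Proof.
move=> w0 ls /andP[k0 lekn]; have [[alls _] _] := ls.
have chainE m : (m <= n.+1)%N -> chain_dim n w (wstar n w s v) m
    = (w 1%N)%:Z - chain_dim n w v (n.+1 - m).
  elim: m => [|m IHm] lemn.
    by rewrite subn0 /chain_dim /= /ext /vert ltnn /= subr0.
  have := IHm (ltnW lemn); have := wstar_diff v w0 alls (ltnSE lemn).
  rewrite (longest_wperm ls) // subSS.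
  have -> : (n - m).+1 = (n.+1 - m)%N by lia.
  lia.
have := chainE k; rewrite /chain_dim (negbTE (lt0n_neq0 k0)).
rewrite ifN; last by apply/eqP; lia.
rewrite /ext /vert k0 lekn.
have -> : (0 < n.+1 - k <= n)%N by lia.
by apply; lia.
Qed.

End DimensionVectors.

(** * Linear maps, coordinates and product subspaces *)

Section LinearMaps.
Variable C : fieldType.
Implicit Types U V : vectType C.

Lemma lbijP U V (f : 'Hom(U, V)) :
  lbij f <-> injective f /\ forall v, exists u, f u = v.
Proof.
split=> [[/eqP/lker0P injf surjf]|[injf surjf]].
  split=> // v; have /memv_imgP[u _ ->] : v \in limg f by rewrite surjf memvf.
  by exists u.
split; first by apply/eqP/lker0P.
apply/eqP; rewrite eqEsubv subvf; apply/subvP => v _.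
by have [u <-] := surjf v; rewrite memv_img ?memvf.
Qed.

Lemma lbij_dim U V (f : 'Hom(U, V)) : lbij f -> \dim {:U} = \dim {:V}.
Proof.
case=> kerf <-; rewrite limg_dim_eq //.
by rewrite kerf capv0.
Qed.

Lemma lbij_inv U V (f : 'Hom(U, V)) : lbij f ->
  [/\ cancel f f^-1%VF, cancel f^-1%VF f & lbij f^-1%VF].
Proof.
case=> kerf imf.
have fK : cancel f f^-1%VF by apply: lker0_lfunK; rewrite kerf.
have fVK : cancel f^-1%VF f by move=> v; rewrite limg_lfunVK ?imf ?memvf.
split=> //; apply/lbijP; split; first exact: can_inj fVK.
by move=> u; exists (f u).
Qed.

Lemma lbij_comp U V V' (g : 'Hom(V, V')) (f : 'Hom(U, V)) :
  lbij g -> lbij f -> lbij (g \o f)%VF.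
Proof.
move=> /lbijP[injg surjg] /lbijP[injf surjf]; apply/lbijP; split=> [u u'|v].
  by rewrite !comp_lfunE => /injg/injf.
by have [v' <-] := surjg v; have [u <-] := surjf v'; exists u; rewrite comp_lfunE.
Qed.

Lemma dim0_eq V (u v : V) : \dim {:V} = 0%N -> u = v.
Proof.
move=> /eqP; rewrite dimv_eq0 => /eqP V0.
suff z (x : V) : x = 0 by rewrite (z u) (z v).
by apply/eqP; rewrite -memv0 -V0 memvf.
Qed.

Lemma dim_gr (d : nat -> nat) i : \dim {:gr C d i} = d i.
Proof. by rewrite dimvf dim_matrix mul1r. Qed.

(** The source has a free parameter [m] instead of [\dim S], so that the map can start from a space
    [gr C d k] whose dimension is only provably that of [S]. *)
Definition basmap V (S : {vspace V}) m : 'Hom('rV[C]_m, V) :=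
  linfun (fun u : 'rV[C]_m => \sum_(k < m) u 0 k *: (vbasis S)`_k).

Lemma basmapE V (S : {vspace V}) m u :
  basmap S m u = \sum_(k < m) u 0 k *: (vbasis S)`_k.
Proof.
apply: linfun_linE => a x y; rewrite scaler_sumr -big_split /=.
by apply: eq_bigr => k _; rewrite !mxE scalerDl scalerA.
Qed.

Lemma basmapP V (S : {vspace V}) m : m = \dim S ->
  injective (basmap S m) /\ limg (basmap S m) = S.
Proof.
move=> ->; split.
  move=> u v; rewrite !basmapE => E; apply/rowP => k.
  have freeS := basis_free (vbasisP S).
  by rewrite -(coord_sum_free (u 0) k freeS) E coord_sum_free.
apply/eqP; rewrite eqEsubv; apply/andP; split; apply/subvP => v.
  case/memv_imgP => u _ ->; rewrite basmapE; apply: memv_suml => k _.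
  by apply/memvZ/vbasis_mem/mem_nth; rewrite size_tuple.
move=> vS; apply/memv_imgP; exists (\row_k coord (vbasis S) k v).
  exact: memvf.
by rewrite basmapE [LHS](coord_vbasis vS); apply: eq_bigr => k _; rewrite mxE.
Qed.

(* For [m = n] this is the identity; it replaces a cast along [m = n]. *)
Definition resize m n : 'Hom('rV[C]_m, 'rV[C]_n) := linfun (mulmxr (pid_mx m)).

Lemma resizeK m n : m = n -> cancel (resize m n) (resize n m).
Proof. by move=> -> u; rewrite !lfunE /= pid_mx_1 !mulmx1. Qed.

Section ProductSubspace.
Variables (V1 V2 : vectType C) (A1 : {vspace V1}) (A2 : {vspace V2}).

Let fstl : 'Hom((V1 * V2)%type, V1) := linfun fst.
Let sndl : 'Hom((V1 * V2)%type, V2) := linfun snd.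
Let inr_ : 'Hom(V2, (V1 * V2)%type) := linfun (fun v => (0, v)).

Definition prodv : {vspace (V1 * V2)%type} :=
  ((fstl @^-1: A1) :&: (sndl @^-1: A2))%VS.

Let fstlE u : fstl u = u.1. Proof. by rewrite lfunE. Qed.
Let sndlE u : sndl u = u.2. Proof. by rewrite lfunE. Qed.
Let inrE v : inr_ v = (0, v).
Proof.
by apply: linfun_linE => a x y; congr (_, _); rewrite /= scaler0 addr0.
Qed.
Lemma mem_prodv u : (u \in prodv) = (u.1 \in A1) && (u.2 \in A2).
Proof. by rewrite memv_cap -!memv_preim fstlE sndlE. Qed.

Lemma dim_prodv : \dim prodv = (\dim A1 + \dim A2)%N.
Proof.
rewrite -(limg_ker_dim fstl) addnC.
have -> : (fstl @: prodv)%VS = A1.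
  apply/eqP; rewrite eqEsubv; apply/andP; split; apply/subvP => v.
    by case/memv_imgP => u; rewrite mem_prodv fstlE => /andP[? _] ->.
  move=> vA; apply/memv_imgP; exists (v, 0); last by rewrite fstlE.
  by rewrite mem_prodv vA mem0v.
have -> : (prodv :&: lker fstl)%VS = (inr_ @: A2)%VS.
  apply/eqP; rewrite eqEsubv; apply/andP; split; apply/subvP => u.
    rewrite memv_cap memv_ker fstlE mem_prodv => /andP[/andP[_ u2] /eqP u1].
    by apply/memv_imgP; exists u.2 => //; rewrite inrE -u1; case: (u).
  case/memv_imgP => v vA ->; rewrite inrE memv_cap memv_ker fstlE mem_prodv.
  by rewrite mem0v vA /= eqxx.
rewrite limg_dim_eq //; apply/eqP; rewrite -subv0; apply/subvP => v.
rewrite memv_cap memv_ker inrE => /andP[_ /eqP[->]].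
exact: mem0v.
Qed.

End ProductSubspace.

End LinearMaps.

(** * Adjoints and orthogonals for bilinear forms *)

Section Forms.
Variable C : fieldType.
Implicit Types U V : vectType C.

Lemma radj_uniq U V (BU : {biscalar U}) (BV : {biscalar V})
    (f : 'Hom(U, V)) (g : 'Hom(V, U)) :
  nondeg BU -> (forall e e', BV (f e) e' = BU e (g e')) -> radj BU BV f = g.
Proof.
move=> nBU fg; apply/lfunP => v; apply/eqP; rewrite -subr_eq0; apply/eqP.
by apply: nBU.2 => e; rewrite linearBr /= -fg -radjP // subrr.
Qed.

Lemma radj_comp U V V' (BU : {biscalar U}) (BV : {biscalar V})
    (BV' : {biscalar V'}) (f : 'Hom(U, V)) (g : 'Hom(V, V')) :
  nondeg BU -> nondeg BV ->
  radj BU BV' (g \o f)%VF = (radj BU BV f \o radj BV BV' g)%VF.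
Proof.
by move=> nU nV; apply: radj_uniq => // e e'; rewrite !comp_lfunE -!radjP.
Qed.

Lemma radj1 U (BU : {biscalar U}) : nondeg BU -> radj BU BU \1%VF = \1%VF.
Proof. by move=> nU; apply: radj_uniq => // e e'; rewrite !id_lfunE. Qed.

Lemma radjB U V (BU : {biscalar U}) (BV : {biscalar V}) (f g : 'Hom(U, V)) :
  nondeg BU -> radj BU BV (f - g) = radj BU BV f - radj BU BV g.
Proof.
move=> nU; apply: radj_uniq => // e e'.
by rewrite !lfun_simp linearBl linearBr /= !(radjP BV _ nU).
Qed.

Lemma radj0 U V (BU : {biscalar U}) (BV : {biscalar V}) :
  nondeg BU -> radj BU BV 0 = 0.
Proof. by move=> nU; rewrite -[X in radj _ _ X](subrr 0) radjB // subrr. Qed.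

(** The adjoint of a left inverse of [f] is a right inverse of the adjoint of [f]. *)
Lemma radj_surj U V (BU : {biscalar U}) (BV : {biscalar V}) (f : 'Hom(U, V)) :
  nondeg BU -> nondeg BV -> injective f -> limg (radj BU BV f) = fullv.
Proof.
move=> nU nV /lker0P injf; apply/eqP; rewrite eqEsubv subvf; apply/subvP => u _.
apply/memv_imgP; exists (radj BV BU f^-1%VF u); rewrite ?memvf //.
by rewrite -comp_lfunE -radj_comp // lker0_compVf // radj1 // id_lfunE.
Qed.

(** This supplies nondegenerate forms on the V_i, without which [tau] could be empty, and an
    auxiliary form for [dim_perp]. *)
Definition dotform d (u v : 'rV[C]_d) : C := \sum_(k < d) u 0 k * v 0 k.

Lemma dotform_bilinear d :
  bilinear_for (GRing.mul : GRing.Scale.law C C) (GRing.mul : GRing.Scale.law C C)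
    (@dotform d).
Proof.
by split=> u a x y; rewrite /= /dotform mulr_sumr -big_split /=;
  apply: eq_bigr => k _; rewrite !mxE ?mulrDl ?mulrDr ?mulrA // (mulrC a).
Qed.

HB.instance Definition _ d :=
  bilinear_isBilinear.Build C _ _ _ _ _ (@dotform d) (dotform_bilinear d).

Lemma dotform_nondeg d : nondeg (@dotform d : {biscalar 'rV[C]_d}).
Proof.
have dE u (k : 'I_d) : dotform u (delta_mx 0 k) = u 0 k.
  rewrite /dotform (bigD1 k) //= mxE !eqxx mulr1 big1 ?addr0 // => j nejk.
  by rewrite mxE (negbTE nejk) mulr0.
have dC u v : dotform u v = dotform v u :> C.
  by apply: eq_bigr => k _; rewrite mulrC.
split=> u u0; apply/rowP => k; rewrite mxE -dE; first exact: u0.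
by rewrite dC; exact: u0.
Qed.

Section Flip.
Variables (V : vectType C) (B : {biscalar V}).

(** The form on [W] need not be symmetric, so its left and right orthogonals and adjoints differ.
    Exchanging the arguments passes from one to the other and gives the inverse of [sigma1]. *)
Definition flip_form (u v : V) : C := B v u.

Lemma flip_bilinear :
  bilinear_for (GRing.mul : GRing.Scale.law C C) (GRing.mul : GRing.Scale.law C C)
    flip_form.
Proof.
by split=> u a x y; rewrite /flip_form; [rewrite linearPr|rewrite linearPl].
Qed.

HB.instance Definition _ :=
  bilinear_isBilinear.Build C _ _ _ _ _ flip_form flip_bilinear.

Lemma flip_nondeg : nondeg B -> nondeg (flip_form : {biscalar V}).
Proof. by case=> nl nr; split. Qed.

End Flip.

Lemma radj_flip V (B : {biscalar V}) (f : 'End(V)) : nondeg B ->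
  radj (flip_form B) (flip_form B) (radj B B f) = f.
Proof.
move=> nB; apply: radj_uniq; first exact: flip_nondeg.
by move=> e e'; rewrite /= /flip_form (radjP B f nB).
Qed.

Lemma flip_radj V (B : {biscalar V}) (f : 'End(V)) : nondeg B ->
  radj B B (radj (flip_form B) (flip_form B) f) = f.
Proof.
move=> nB; apply: radj_uniq => // e e'.
exact/esym/(radjP (flip_form B) f (flip_nondeg nB) e' e).
Qed.

(** The orthogonal is the kernel of the adjoint of an injection with image [S], and this adjoint is
    surjective. *)
Lemma dim_perp V (B : {biscalar V}) (S : {vspace V}) : nondeg B ->
  (\dim (perp B S) + \dim S = \dim {:V})%N.
Proof.
move=> nB; have [m mE] : exists m : nat, m = \dim S by exists (\dim S).
have [injb imb] := basmapP mE; set b := basmap S m in injb imb.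
pose D := @dotform m : {biscalar 'rV[C]_m}.
have nD : nondeg D := dotform_nondeg _.
have dimi : \dim (limg (radj D B b)) = m.
  by rewrite radj_surj // dimvf dim_matrix mul1r.
rewrite -(limg_ker_dim (radj D B b) fullv) dimi -mE capfv.
congr (\dim _ + _)%N; apply/eqP; rewrite eqEsubv.
apply/andP; split; apply/subvP => u.
  move=> /memv_perp uS; rewrite memv_ker; apply/eqP/nD.2 => e.
  by rewrite -radjP //; apply: uS; rewrite -imb memv_img ?memvf.
rewrite memv_ker => /eqP u0; apply/memv_perp => e.
by rewrite -imb => /memv_imgP[c _ ->]; rewrite (radjP B b nD) u0 linear0r.
Qed.

Lemma perpS V (B : {biscalar V}) (S T : {vspace V}) :
  (S <= T)%VS -> (perp B T <= perp B S)%VS.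
Proof.
move=> /subvP ST; apply/subvP => u /memv_perp uT.
by apply/memv_perp => e /ST; apply: uT.
Qed.

Lemma perp0 V (B : {biscalar V}) : perp B 0%VS = fullv.
Proof.
apply/eqP; rewrite eqEsubv subvf; apply/subvP => u _.
by apply/memv_perp => e; rewrite memv0 => /eqP ->; rewrite linear0l.
Qed.

Lemma perpf V (B : {biscalar V}) : nondeg B -> perp B fullv = 0%VS.
Proof.
move=> nB; apply/eqP; rewrite -subv0; apply/subvP => u /memv_perp u0.
by rewrite memv0; apply/eqP/nB.2 => e; apply/u0/memvf.
Qed.

Lemma perpK V (B : {biscalar V}) (S : {vspace V}) : nondeg B ->
  perp (flip_form B) (perp B S) = S.
Proof.
move=> nB; apply/esym/eqP; rewrite eqEdim; apply/andP; split.
  apply/subvP => e eS; apply/memv_perp => u /memv_perp; exact.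
have := dim_perp (perp B S) (flip_nondeg nB); have := dim_perp S nB.
by move=> <- /eqP; rewrite addnC eqn_add2l => /eqP ->.
Qed.

Lemma perpVK V (B : {biscalar V}) (S : {vspace V}) : nondeg B ->
  perp B (perp (flip_form B) S) = S.
Proof.
move=> nB; apply/esym/eqP; rewrite eqEdim; apply/andP; split.
  apply/subvP => e eS; apply/memv_perp => u /memv_perp; exact.
have := dim_perp (perp (flip_form B) S) nB; have := dim_perp S (flip_nondeg nB).
by move=> <- /eqP; rewrite addnC eqn_add2l => /eqP ->.
Qed.

End Forms.

(** * Points as chains, semistability for positive weights, injectivity of phi *)

Section Chains.
Variables (C : fieldType) (W : nat -> vectType C).
Implicit Types (x : rep W) (n i k : nat) (xi v : nat -> int).

Local Notation V x i := (gr C (dimr x) i).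

(** At a successor this reduces to the space of the quiver, so vectors of the chain and of the
    quiver are identified without casts. *)
Definition chain x k : vectType C := if k is k'.+1 then V x k'.+1 else W 1.

Definition cx x k : 'Hom(chain x k, chain x k.+1) :=
  match k with 0%N => rp x 1 | k'.+1 => rx x k'.+1 end.

Definition cy x k : 'Hom(chain x k.+1, chain x k) :=
  match k with 0%N => rq x 1 | k'.+1 => ry x k'.+1 end.

Fixpoint cpath x k : 'Hom(chain x k, W 1) :=
  match k with 0%N => \1%VF | k'.+1 => (cpath x k' \o cy x k')%VF end.

Lemma muE x i u :
  mu x i u = ry x i (rx x i u) - rxm x i (rym x i u) - rp x i (rq x i u).
Proof. by rewrite /mu !lfun_simp. Qed.

Lemma gr_eq x i (u v : V x i) : dimr x i = 0%N -> u = v.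
Proof. by move=> d0; apply: dim0_eq; rewrite dim_gr. Qed.

Lemma dim_is0 n x v i : dim_is n x v -> ~~ vert n i -> dimr x i = 0%N.
Proof. by move=> /(_ i) + /negbTE vi; rewrite vi => -[]. Qed.

Hypothesis hW : forall i, i <> 1%N -> \dim {:W i} = 0%N.

Lemma W_eq i (u v : W i) : i <> 1%N -> u = v.
Proof. by move=> /hW; apply: dim0_eq. Qed.

(** At vertex 1 the loop through V_0 vanishes and the framing loop takes its place; at the other
    vertices the framing loop vanishes. *)
Lemma chain_rel x : dimr x 0%N = 0%N -> (forall i, mu x i = 0) ->
  forall k u, cy x k.+1 (cx x k.+1 u) = cx x k (cy x k u).
Proof.
move=> d0 mu0 k u; have := muE u; rewrite mu0 lfunE /= => /esym/eqP.
rewrite subr_eq0 subr_eq => /eqP ->.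
case: k u => [|k] u /=.
  by rewrite (gr_eq (ry x 0 u) 0 d0) linear0 addr0.
by rewrite (W_eq (rq x k.+2 u) 0) // linear0 add0r.
Qed.

Lemma phi_repE n x :
  phi_rep n x = ((cy x 0 \o cx x 0)%VF, [ffun i : 'I_n.+2 => limg (cpath x i)]).
Proof.
have yE k : (rq x 1 \o ypath x k)%VF = cpath x k.+1.
  elim: k => [|k IHk] /=; first by rewrite comp_lfun1l comp_lfun1r.
  by rewrite comp_lfunA IHk.
congr (_, _); apply/ffunP => i; rewrite !ffunE.
by case: (i : nat) => [|k]; rewrite ?lim1g ?yE.
Qed.

(** Seen in [W 1], every [cx] is the one endomorphism [cy x 0 \o cx x 0]. When the paths are
    injective, that endomorphism therefore determines all the [cx]. *)
Lemma cpath_rel x : dimr x 0%N = 0%N -> (forall i, mu x i = 0) ->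
  forall k u, cy x 0 (cx x 0 (cpath x k u)) = cpath x k.+1 (cx x k u).
Proof.
move=> d0 mu0; elim=> [|k IHk] u; first by rewrite /= !lfun_simp.
rewrite [cpath x k.+1 u]comp_lfunE IHk -chain_rel //.
by rewrite [RHS]comp_lfunE.
Qed.

Lemma cpath_inj x k : (forall k, injective (cy x k)) -> injective (cpath x k).
Proof.
move=> injy; elim: k => [|k IHk] u u' /=; first by rewrite !lfun_simp.
by rewrite !comp_lfunE => /IHk/injy.
Qed.

Lemma limg_cpath_nonvert n x k : (forall i, ~~ vert n i -> dimr x i = 0%N) ->
  (n < k)%N -> limg (cpath x k) = 0%VS.
Proof.
case: k => // k d0 ltnk; apply/eqP; rewrite -dimv_eq0 -leqn0.
apply: leq_trans (_ : \dim {:chain x k.+1} <= 0)%N.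
  by rewrite -(limg_ker_dim (cpath x k.+1) fullv) leq_addl.
by rewrite dim_gr d0 //; apply/negP => /andP[]; lia.
Qed.

Lemma cy_inj_stable0 x (S : forall i, {vspace V x i}) :
  dimr x 0%N = 0%N -> (forall k, injective (cy x k)) -> stable S ->
  (forall i, (S i <= lker (rq x i))%VS) -> forall i, S i = 0%VS.
Proof.
move=> d0 injy stS Sq [|i].
  by apply/eqP; rewrite -subv0; apply/subvP => u _; rewrite (gr_eq u 0 d0) mem0v.
elim: i => [|i IHi]; apply/eqP; rewrite -subv0; apply/subvP => u uS.
  have /subvP/(_ u uS) := Sq 1%N; rewrite memv_ker => /eqP qu.
  by rewrite memv0; apply/eqP/(injy 0%N); rewrite /= qu linear0.
have /subvP := (stS i.+1).2; move=> /(_ (ry x i.+1 u)).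
rewrite IHi memv_img // memv0 => /(_ isT)/eqP yu.
by rewrite memv0; apply/eqP/(injy i.+1); rewrite /= yu linear0.
Qed.

(** This is the test subspace for (S1) that detects a path with a kernel. *)
Lemma kernel_stable x : dimr x 0%N = 0%N -> (forall i, mu x i = 0) ->
  let S i : {vspace V x i} :=
    match i with 0%N => 0%VS | k.+1 => lker (cpath x k.+1) end in
  stable S /\ forall i, (S i <= lker (rq x i))%VS.
Proof.
move=> d0 mu0 S; split=> [i|i]; last first.
  case: i => [|[|i]]; first exact: sub0v.
    by rewrite /S /= comp_lfun1l.
  apply/subvP => u _; rewrite memv_ker; apply/eqP/W_eq; lia.
case: i => [|i]; split; apply/subvP => u /memv_imgP[u' u'S ->].
- by rewrite (gr_eq u' 0 d0) linear0 mem0v.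
- by rewrite (gr_eq (ry x 0 u') 0 d0) mem0v.
- move: u'S; rewrite !memv_ker => /eqP u'0.
  by have := @cpath_rel x d0 mu0 i.+1 u'; rewrite u'0 !linear0 => /esym/eqP.
- by move: u'S; rewrite /S !memv_ker [cpath x i.+2]/= comp_lfunE.
Qed.

Lemma pos_dotw_eq n xi d d' : (forall i, vert n i -> 0 < xi i) ->
  (forall i, vert n i -> d i <= d' i) -> dotw n xi d' <= dotw n xi d ->
  forall i, vert n i -> d i = d' i.
Proof.
move=> xi0 led ledot.
have : \sum_(1 <= i < n.+1 | vert n i) xi i * (d' i - d i) == 0.
  rewrite eq_le sumr_ge0 ?andbT => [|i vi]; last first.
    by rewrite mulr_ge0 ?subr_ge0 ?led // ltW ?xi0.
  rewrite -big_nat; rewrite -subr_le0 -sumrB in ledot.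
  by under eq_bigr do rewrite mulrBr.
rewrite psumr_eq0 => [|i vi]; last by rewrite mulr_ge0 ?subr_ge0 ?led // ltW ?xi0.
move=> /allP E i vi; have := E i; rewrite mem_index_iota [(_ <= _ < _)%N]vi.
rewrite vi mulf_eq0 gt_eqF ?xi0 //= subr_eq0 => /(_ isT)/eqP ->.
by [].
Qed.

(** With injective [cy], a stable subspace killed by [q] vanishes vertex by vertex from 1 upwards,
    and (S2) is monotonicity of dimension. Conversely (S1) makes the kernels of the paths zero. *)
Lemma pos_semistable n xi x : (forall i, vert n i -> 0 < xi i) ->
  (forall i, ~~ vert n i -> dimr x i = 0%N) -> (forall i, mu x i = 0) ->
  semistable n xi x <-> forall k, injective (cy x k).
Proof.
move=> xi0 dx mu0; have d0 : dimr x 0%N = 0%N by apply: dx.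
split=> [[ss _] k|injy]; last first.
  split=> [S stS /(cy_inj_stable0 d0 injy stS) S0 | T _ _].
    by rewrite /dotw big1_seq // => i _; rewrite S0 dimv0 mulr0.
  rewrite /dotw big_nat [leRHS]big_nat; apply: ler_sum => i vi.
  apply: ler_wpM2l; first by rewrite ltW ?xi0.
  rewrite lez_nat -(dim_gr C).
  exact/dimvS/subvf.
have [stS Sq] := kernel_stable d0 mu0.
set S := (fun i => _) in stS Sq.
have dimS i : vert n i -> 0 = (\dim (S i))%:Z.
  move: i; apply: (pos_dotw_eq (d' := fun i => (\dim (S i))%:Z) xi0) => //.
  have -> : dotw n xi (fun=> 0) = 0 by rewrite /dotw big1 // => j; rewrite mulr0.
  exact: ss.
apply/lker0P; rewrite -subv0; apply/subvP => u.
have [vk|nvk] := boolP (vert n k.+1); last first.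
  by rewrite (@gr_eq x k.+1 u 0) ?mem0v // dx.
have /esym/eqP := dimS _ vk; rewrite eqz_nat dimv_eq0 => /eqP Sk u0.
have <- : S k.+1 = 0%VS := Sk.
move: u0; rewrite !memv_ker comp_lfunE => /eqP ->.
by rewrite linear0.
Qed.

Lemma same_orbit_sym x x' : same_orbit x x' -> same_orbit x' x.
Proof.
case=> g [gb gE]; exists (fun i => (g i)^-1%VF); split=> i.
  by have [] := lbij_inv (gb i).
have [gK gVK _] := lbij_inv (gb i); have [gK1 gVK1 _] := lbij_inv (gb i.+1).
have [xE yE pE qE] := gE i; split; apply/lfunP => u; rewrite !comp_lfunE.
- apply: (can_inj gK1); rewrite gVK1 -[LHS]comp_lfunE -xE comp_lfunE gVK.
  by [].
- apply: (can_inj gK); rewrite gVK -[LHS]comp_lfunE -yE comp_lfunE gVK1.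
  by [].
- by rewrite pE comp_lfunE gK.
- by rewrite -[in LHS]qE comp_lfunE gVK.
Qed.

Lemma same_orbit_trans x x' x'' :
  same_orbit x x' -> same_orbit x' x'' -> same_orbit x x''.
Proof.
case=> g [gb gE] [h [hb hE]]; exists (fun i => (h i \o g i)%VF).
split=> i; first exact: lbij_comp.
have [xE yE pE qE] := gE i; have [xE' yE' pE' qE'] := hE i.
split; rewrite ?comp_lfunA.
- by rewrite xE' -!comp_lfunA xE.
- by rewrite yE' -!comp_lfunA yE.
- by rewrite pE' pE comp_lfunA.
- by rewrite qE' qE.
Qed.

Lemma same_orbit_refl x : same_orbit x x.
Proof.
exists (fun=> \1%VF); split=> i; last by rewrite !comp_lfun1l !comp_lfun1r.
by apply/lbijP; split=> [u v|u]; [rewrite !id_lfunE | exists u; rewrite id_lfunE].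
Qed.

Lemma Gorbit_eq x x' : same_orbit x x' -> Gorbit x = Gorbit x'.
Proof.
move=> xx'; apply/seteqP; split=> z; last exact: same_orbit_trans.
by apply: same_orbit_trans; apply: same_orbit_sym.
Qed.

(** Injective paths identify both V_k with the same space of the flag, and comparing the two
    identifications gives the isomorphism. *)
Lemma phi_rep_inj n x x' :
  (forall i, ~~ vert n i -> dimr x i = 0%N) ->
  (forall i, ~~ vert n i -> dimr x' i = 0%N) ->
  (forall i, mu x i = 0) -> (forall i, mu x' i = 0) ->
  (forall k, injective (cy x k)) -> (forall k, injective (cy x' k)) ->
  phi_rep n x = phi_rep n x' -> same_orbit x x'.
Proof.
move=> dx dx' mx mx' ix ix'; rewrite !phi_repE => -[qpE /ffunP FE].
have d0 : dimr x 0%N = 0%N by apply: dx.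
have d0' : dimr x' 0%N = 0%N by apply: dx'.
have imE k : limg (cpath x k) = limg (cpath x' k).
  have [lekn|ltnk] := leqP k n.+1.
    by have := FE (Ordinal (lekn : (k < n.+2)%N)); rewrite !ffunE.
  by rewrite !(@limg_cpath_nonvert n) // ltnW.
pose g k : 'Hom(chain x k, chain x' k) := ((cpath x' k)^-1 \o cpath x k)%VF.
have gE k u : cpath x' k (g k u) = cpath x k u.
  by rewrite comp_lfunE limg_lfunVK // -imE memv_img ?memvf.
have g0 u : g 0%N u = u by have := gE 0%N u; rewrite /= !id_lfunE.
have yE k u : cy x' k (g k.+1 u) = g k (cy x k u).
  apply: (cpath_inj (k := k) ix'); rewrite gE.
  by have := gE k.+1 u; rewrite !comp_lfunE.
have xE k u : cx x' k (g k u) = g k.+1 (cx x k u).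
  apply: (cpath_inj (k := k.+1) ix'); rewrite gE -!cpath_rel // gE.
  by rewrite -!comp_lfunE qpE.
have gb k : lbij (g k).
  apply/lbijP; split=> [u u' E|u'].
    by apply: (cpath_inj (k := k) ix); rewrite -!gE E.
  have : cpath x' k u' \in limg (cpath x k) by rewrite imE memv_img ?memvf.
  case/memv_imgP => u _ E; exists u.
  by apply: (cpath_inj (k := k) ix'); rewrite gE.
(* At position 0 the map [g] acts on [W 1], whereas the orbit relation wants a map between the zero
   spaces at vertex 0. *)
clearbody g; pose h i : 'Hom(V x i, V x' i) :=
  match i with 0%N => 0 | k.+1 => g k.+1 end.
exists h; split=> i.
  case: i => [|i]; last exact: (gb i.+1).
  apply/lbijP; split=> [u v _|v]; first exact: gr_eq.
  by exists 0; apply: gr_eq.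
split; apply/lfunP => u; rewrite !comp_lfunE.
- case: i u => [|i] u; last exact: (xE i.+1).
  by rewrite (gr_eq u 0 d0) !linear0.
- by case: i u => [|i] u; [apply: gr_eq | exact: (yE i.+1)].
- case: i u => [|[|i]] u; first exact: gr_eq.
    by have := xE 0%N u; rewrite g0.
  by rewrite (W_eq u 0) // !linear0.
- case: i u => [|[|i]] u; [exact: W_eq | | exact: W_eq].
  by have := yE 0%N u; rewrite g0.
Qed.

End Chains.

(** * Every flag comes from a point *)

Section FlagParametrization.
Variables (C : fieldType) (W : nat -> vectType C).
Implicit Types (x : rep W) (n i k : nat) (xi v : nat -> int).
Hypothesis hW : forall i, i <> 1%N -> \dim {:W i} = 0%N.

Lemma mu_chain x : dimr x 0%N = 0%N ->
  (forall k u, cy x k.+1 (cx x k.+1 u) = cx x k (cy x k u)) ->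
  forall i, mu x i = 0.
Proof.
move=> d0 rel [|i]; apply/lfunP => u; first exact: gr_eq.
rewrite muE lfunE /=; apply/eqP; rewrite subr_eq0 subr_eq; apply/eqP.
case: i u => [|i] u /=.
  rewrite (gr_eq (ry x 0 u) 0 d0) linear0 addr0; exact: (rel 0%N).
by rewrite (W_eq hW (rq x i.+2 u) 0) // linear0 add0r; exact: (rel i.+1).
Qed.

Section Realization.
Variables (n : nat) (X : 'End(W 1)) (F : nat -> {vspace W 1}).
Hypothesis F0 : F 0%N = fullv.
Hypothesis Fn : forall k, (n < k)%N -> F k = 0%VS.
Hypothesis FS : forall k, (F k.+1 <= F k)%VS.
Hypothesis XF : forall k, (X @: F k <= F k.+1)%VS.

Let d k := if k is 0%N then 0%N else \dim (F k).
Let b k : 'Hom(gr C d k, W 1) := basmap (F k) (d k).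

(** This is the chain of the F_k in coordinates, with inclusions one way and restrictions of [X] the
    other. The dimension at 0 is set to 0 although [F 0] is [W], because [W] enters only as
    framing. *)
Definition flag_rep : rep W := @Rep C W d
  (fun i => (b i.+1)^-1 \o X \o b i)%VF
  (fun i => (b i)^-1 \o b i.+1)%VF
  (fun i => if i is 1%N then (b 1)^-1 \o X else 0)%VF
  (fun i => if i is 1%N then b 1 else 0).

Let c k : 'Hom(chain flag_rep k, W 1) :=
  match k with 0%N => \1%VF | k.+1 => b k.+1 end.

Let c_inj k : injective (c k).
Proof.
case: k => [|k] /=; first by move=> u v; rewrite !id_lfunE.
by have [] := @basmapP _ _ (F k.+1) (d k.+1).
Qed.

Let c_im k : limg (c k) = F k.
Proof.
case: k => [|k]; first by rewrite lim1g F0.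
by have [] := @basmapP _ _ (F k.+1) (d k.+1).
Qed.

Let c_cy k u : c k (cy flag_rep k u) = c k.+1 u.
Proof.
case: k u => [|k] u; first by rewrite /= id_lfunE.
rewrite [cy _ _ u]comp_lfunE limg_lfunVK // -[limg _]/(limg (c k.+1)) c_im.
by apply: (subvP (FS _)); rewrite -c_im memv_img ?memvf.
Qed.

Let c_cx k u : c k.+1 (cx flag_rep k u) = X (c k u).
Proof.
have -> : cx flag_rep k u = (b k.+1)^-1%VF (X (c k u)).
  by case: k u => [|k] u; rewrite /= ?id_lfunE !comp_lfunE.
rewrite limg_lfunVK // -[limg _]/(limg (c k.+1)) c_im.
by apply: (subvP (XF _)); rewrite memv_img // -c_im memv_img ?memvf.
Qed.

Lemma flag_rep_dim k : (0 < k)%N -> dimr flag_rep k = \dim (F k).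
Proof. by case: k. Qed.

Lemma flag_rep_dim0 k : ~~ vert n k -> dimr flag_rep k = 0%N.
Proof.
case: k => // k; rewrite /vert /= -ltnNge => ltnk.
by rewrite Fn ?dimv0 // ltnW.
Qed.

Lemma flag_rep_mu i : mu flag_rep i = 0.
Proof.
apply: mu_chain => // k u; apply: (@c_inj k.+1).
by rewrite c_cy !c_cx c_cy.
Qed.

Lemma flag_rep_inj k : injective (cy flag_rep k).
Proof. by move=> u v E; apply: (@c_inj k.+1); rewrite -!c_cy E. Qed.

Lemma flag_rep_phi :
  phi_rep n flag_rep = (X, [ffun i : 'I_n.+2 => F i]).
Proof.
have pathE k u : cpath flag_rep k u = c k u.
  elim: k u => [|k IHk] u //.
  by rewrite [LHS]comp_lfunE IHk c_cy.
rewrite phi_repE; congr (_, _).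
  apply/lfunP => u; rewrite comp_lfunE.
  by have := c_cy (cx flag_rep 0 u); rewrite c_cx /= !id_lfunE.
apply/ffunP => i; rewrite !ffunE -c_im; congr (limg _).
by apply/lfunP => u; rewrite pathE.
Qed.

End Realization.

Lemma pos_locusP n xi v x : (forall i, vert n i -> 0 < xi i) ->
  semistable_locus n xi v x <->
  [/\ dim_is n x v, forall i, mu x i = 0 & forall k, injective (cy x k)].
Proof.
move=> xi0; split=> -[dx mx ss]; split=> //;
  have [] := pos_semistable hW xi0 (fun i => dim_is0 dx) mx;
  by [move=> /(_ ss)|move=> _ /(_ ss)].
Qed.

Lemma phi_rep_flag n xi v x : (forall i, vert n i -> 0 < xi i) ->
  semistable_locus n xi v x -> Tflagvar (W 1%N) n v (phi_rep n x).
Proof.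
move=> xi0 /(pos_locusP _ _ xi0) [dx mx ix].
have d0 i : ~~ vert n i -> dimr x i = 0%N by apply: dim_is0 dx.
have d00 : dimr x 0%N = 0%N by apply: d0.
rewrite phi_repE; split=> /=.
  split.
  - by rewrite ffunE lim1g.
  - by rewrite ffunE (limg_cpath_nonvert d0).
  - move=> i j leij; rewrite !ffunE; move: (nat_of_ord i) (nat_of_ord j) leij.
    move=> k l /subnK <-; elim: (l - k)%N => // m IHm.
    apply: subv_trans IHm; rewrite addSn /= limg_comp.
    exact/limgS/subvf.
  - move=> i vi; rewrite ffunE limg_dim_eq; last first.
      by rewrite (_ : lker _ = 0%VS) ?capv0 //; apply/eqP/lker0P/cpath_inj.
    have := dx i; rewrite vi => <-.
    by case: (nat_of_ord i) vi => // k _; rewrite dim_gr.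
move=> i j ij; rewrite !ffunE ij; apply/subvP => w.
case/memv_imgP => _ /memv_imgP[u _ ->] ->.
by rewrite comp_lfunE (cpath_rel hW) // memv_img ?memvf.
Qed.

Lemma phi_set_bij n xi v : (forall i, vert n i -> 0 < xi i) ->
  set_bij (Nakajima W n xi v) (Tflagvar (W 1%N) n v) (phi n).
Proof.
move=> xi0; split.
- by move=> _ [x xM <-]; rewrite phi_Gorbit; apply: phi_rep_flag xM.
- move=> X X'; rewrite !inE => -[x xM <-] [x' xM' <-]; rewrite !phi_Gorbit => E.
  move: xM xM' => /(pos_locusP _ _ xi0)[dx mx ix].
  move=> /(pos_locusP _ _ xi0)[dx' mx' ix'].
  apply/Gorbit_eq/(phi_rep_inj hW _ _ mx mx' ix ix' E) => i.
    exact: dim_is0 dx.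
  exact: dim_is0 dx'.
- move=> [X F] [[/= F0 Fn FS Fdim] XF].
  (* The flag is indexed by ordinals; the realization needs it continued by zero. *)
  pose G k := if (k < n.+2)%N then F (inord k) else 0%VS.
  have GE (i : 'I_n.+2) : G i = F i by rewrite /G ltn_ord inord_val.
  have G0 : G 0%N = fullv by rewrite (GE ord0).
  have Gn k : (n < k)%N -> G k = 0%VS.
    rewrite /G; case: ifP => // ltk2 ltnk; rewrite -Fn; congr (F _).
    by apply: val_inj; rewrite /= inordK //; lia.
  have GS k : (G k.+1 <= G k)%VS.
    rewrite /G; case: ifP => [ltk|_]; last exact: sub0v.
    by rewrite ltnW //; apply: FS; rewrite !inordK // ltnW.
  have XG k : (X @: G k <= G k.+1)%VS.
    have [ltkn|lenk] := ltnP k n.+1.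
      by rewrite /G (leqW ltkn) ltnS ltkn; apply: XF; rewrite !inordK // ltnW.
    by rewrite Gn // limg0 sub0v.
  exists (Gorbit (flag_rep X G)).
    exists (flag_rep X G) => //; apply/(pos_locusP _ _ xi0); split.
    + move=> i; case: ifP => vi; last by rewrite (flag_rep_dim0 _ Gn) ?vi.
      have /andP[i0 lein] := vi; rewrite flag_rep_dim //.
      have lti : (i < n.+2)%N by lia.
      by have := Fdim (Ordinal lti) vi; rewrite -GE.
    + exact: flag_rep_mu.
    + exact: flag_rep_inj.
  rewrite phi_Gorbit (flag_rep_phi _ G0 GS XG); congr (_, _).
  by apply/ffunP => i; rewrite ffunE GE.
Qed.

End FlagParametrization.

(** * The transpose *)

Section Transpose.
Variables (C : fieldType) (W : nat -> vectType C).
Implicit Types (x : rep W) (n i k : nat) (xi v : nat -> int).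
Hypothesis hW : forall i, i <> 1%N -> \dim {:W i} = 0%N.
Variable B : forall i, {biscalar (W i)}.
Hypothesis hB : forall i, nondeg (B i).

Fixpoint cxpath x k : 'Hom(W 1, chain x k) :=
  match k with 0%N => \1%VF | k'.+1 => (cx x k' \o cxpath x k')%VF end.

Section OneForm.
Variables (x : rep W) (BV : forall i, {biscalar (gr C (dimr x) i)}).
Hypothesis hBV : forall i, nondeg (BV i).

Local Notation x' := (transpose B BV).

Definition chain_form k : {biscalar (chain x k)} :=
  match k with 0%N => B 1 | k'.+1 => BV k'.+1 end.

Lemma chain_form_nondeg k : nondeg (chain_form k).
Proof. by case: k => [|k] /=; [apply: hB|apply: hBV]. Qed.

Lemma transpose_cx k e (u : chain x' k) :
  chain_form k.+1 e (cx x' k u) = - chain_form k (cy x k e) u.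
Proof.
case: k e u => [|k] e u; rewrite /= opp_lfunE linearNr /=; congr (- _).
  by rewrite -(radjP (B 1) (rq x 1) (hBV 1)).
by rewrite -(radjP (BV k.+1) (ry x k.+1) (hBV k.+2)).
Qed.

Lemma transpose_cy k e (u : chain x' k.+1) :
  chain_form k e (cy x' k u) = chain_form k.+1 (cx x k e) u.
Proof.
case: k e u => [|k] e u /=.
  by rewrite -(radjP (BV 1) (rp x 1) (hB 1)).
by rewrite -(radjP (BV k.+2) (rx x k.+1) (hBV k.+1)).
Qed.

Lemma transpose_cxpath k e (w : W 1) :
  chain_form k e (cxpath x' k w) = (-1) ^+ k * B 1 (cpath x k e) w.
Proof.
elim: k e => [|k IHk] e; first by rewrite /= !id_lfunE mul1r.
rewrite [cxpath _ _]/= [in LHS]comp_lfunE transpose_cx IHk.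
by rewrite [cpath x k.+1]/= comp_lfunE exprS mulN1r mulNr.
Qed.

Lemma transpose_cxpath0 k (w : W 1) :
  cxpath x' k w = 0 <-> w \in perp (B 1) (limg (cpath x k)).
Proof.
rewrite memv_perp; split=> [w0 _ /memv_imgP[e _ ->]|w0].
  have /eqP := transpose_cxpath e w; rewrite w0 linear0r eq_sym.
  by rewrite mulf_eq0 signr_eq0 /= => /eqP.
apply: (chain_form_nondeg k).2 => e.
by rewrite transpose_cxpath w0 ?mulr0 // memv_img ?memvf.
Qed.

Lemma transpose_rel : (forall k u, cy x k.+1 (cx x k.+1 u) = cx x k (cy x k u)) ->
  forall k u, cy x' k.+1 (cx x' k.+1 u) = cx x' k (cy x' k u).
Proof.
move=> rel k u; apply/eqP; rewrite -subr_eq0; apply/eqP.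
apply: (chain_form_nondeg k.+1).2 => e; rewrite linearBr.
by rewrite transpose_cy !transpose_cx transpose_cy rel subrr.
Qed.

Lemma transpose_qp :
  (cy x' 0 \o cx x' 0)%VF = - radj (B 1) (B 1) (cy x 0 \o cx x 0)%VF.
Proof.
apply/lfunP => w; apply/eqP; rewrite -subr_eq0; apply/eqP.
apply: (hB 1).2 => e; rewrite linearBr.
have -> : B 1 e ((cy x' 0 \o cx x' 0)%VF w)
    = chain_form 0 e (cy x' 0 (cx x' 0 w)).
  by rewrite comp_lfunE.
rewrite transpose_cy transpose_cx opp_lfunE linearNr.
by rewrite -(radjP (B 1) _ (hB 1)) comp_lfunE subrr.
Qed.

Lemma transpose_cx_surj k : injective (cy x k) ->
  limg (cx x' k) = fullv.
Proof.
move=> injy.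
have := radj_surj (chain_form_nondeg k.+1) (chain_form_nondeg k) injy.
suff -> : cx x' k = - radj (chain_form k.+1) (chain_form k) (cy x k).
  move=> im; apply/eqP; rewrite eqEsubv subvf -im; apply/subvP => u.
  case/memv_imgP => u' _ ->; apply/memv_imgP; exists (- u'); rewrite ?memvf //.
  by rewrite opp_lfunE linearN opprK.
by case: (k).
Qed.

(** For negative weights (S1) is automatic. The adjoints of injective [cy] are surjective, so a
    stable subspace containing the image of [p] is everything, and (S2) holds. *)
Lemma transpose_locus n xi v : (forall i, vert n i -> 0 < xi i) ->
  semistable_locus n xi v x -> semistable_locus n (fun i => - xi i) v x'.
Proof.
move=> xi0 /(pos_locusP hW _ _ xi0) [dx mx ix].
have d00 : dimr x 0%N = 0%N by apply: dim_is0 dx _.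
split=> //.
  by apply: (mu_chain hW) => //; apply/transpose_rel/(chain_rel hW).
have dotN d : dotw n (fun i => - xi i) d = - dotw n xi d.
  by rewrite /dotw -sumrN; apply: eq_bigr => i _; rewrite mulNr.
split=> [S _ _|T stT pT]; rewrite !dotN.
  rewrite oppr_le0 /dotw big_nat sumr_ge0 // => i vi.
  by rewrite mulr_ge0 // ltW // xi0.
rewrite lerN2 /dotw big_nat [leRHS]big_nat; apply: ler_sum => i vi.
apply: ler_wpM2l; first by rewrite ltW ?xi0.
rewrite lez_nat -(dim_gr C); apply/dimvS.
case: i vi => // i _; elim: i => [|i IHi].
  by rewrite -(transpose_cx_surj (ix 0%N)); apply: pT.
rewrite -(transpose_cx_surj (ix i.+1)); apply: subv_trans (stT i.+1).1.
exact: limgS.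
Qed.

End OneForm.

End Transpose.

(** * Zigzag spaces in the two extreme chambers *)

Section Zigzag.
Variables (C : fieldType) (W : nat -> vectType C).
Implicit Types (x : rep W) (n i k m : nat) (J : nat -> bool).
Hypothesis hW : forall i, i <> 1%N -> \dim {:W i} = 0%N.

Definition edge x J k (u : chain x k) (u' : chain x k.+1) : Prop :=
  if J k then u = cy x k u' else u' = cx x k u.

(* If [xi_j = theta_{j-1} - theta_j] and the values [theta_k], [k \in J], are the
   [m] largest among [theta_0, ..., theta_n], then the [w] with [zigzag x J w]
   form the [m]-th space of the flag of [x] in the chamber of [xi]. *)
Definition zigzag x J (w : W 1) : Prop :=
  exists u : forall k, chain x k,
    u 0%N = w /\ forall k, edge J (u k) (u k.+1).

(** Since the paths are injective, a sequence can be prescribed by its images in [W 1] and then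
    lifted. *)
Lemma zigzag_pos n x J m w : (forall i, ~~ vert n i -> dimr x i = 0%N) ->
  (forall i, mu x i = 0) -> (forall k, injective (cy x k)) -> (m <= n.+1)%N ->
  (forall k, (k <= n)%N -> J k = (k < m)%N) ->
  zigzag x J w <-> w \in limg (cpath x m).
Proof.
move=> dx mx ix lemn JE; have d0 : dimr x 0%N = 0%N by apply: dx.
split=> [[u [<- uE]]|/memv_imgP[t _ wE]].
  have pathE k : (k <= m)%N -> cpath x k (u k) = u 0%N.
    elim: k => [|k IHk] ltkm; first by rewrite /= id_lfunE.
    have := uE k; rewrite /edge JE ?ltkm; last by lia.
    by move=> uk; rewrite /= comp_lfunE -uk IHk // ltnW.
  by apply/memv_imgP; exists (u m); rewrite ?memvf ?pathE.
pose X := (cy x 0 \o cx x 0)%VF.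
(* The image in [W 1] of the wanted [u k]: constant up to [m], by truncated subtraction, then
   multiplied by [X] at every further edge as in [cpath_rel]. *)
pose z k := iter (k - m) X w.
have zS k : (m <= k)%N -> z k.+1 = X (z k) by move=> ?; rewrite /z subSn.
have z_im k : exists t, z k = cpath x k t.
  have [lekm|ltmk] := leqP k m.
    have -> : z k = w by rewrite /z (eqP lekm).
    rewrite wE; move: t {wE z zS}; rewrite -(subnK lekm).
    elim: (m - k)%N => [|l IHl] t; first by exists t.
    by rewrite /= comp_lfunE; apply: IHl.
  rewrite -(subnK (ltnW ltmk)); elim: (k - m)%N => [|l [t' IHl]].
    by exists t; rewrite /z subnn.
  rewrite addSn; exists (cx x _ t'); rewrite zS ?leq_addl // IHl.
  by rewrite -(cpath_rel hW) // !comp_lfunE.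
pose u k := (cpath x k)^-1%VF (z k).
have uE k : cpath x k (u k) = z k.
  by rewrite limg_lfunVK //; have [t' ->] := z_im k; rewrite memv_img ?memvf.
exists u; split=> [|k].
  by have := uE 0%N; rewrite /= id_lfunE /z sub0n.
have [lekn|ltnk] := leqP k n; last first.
  have dk i : (n < i)%N -> dimr x i = 0%N.
    by move=> ?; apply: dx; apply/negP => /andP[]; lia.
  case: k ltnk => // k ltnk; rewrite /edge.
  by case: ifP => _; apply: gr_eq; rewrite dk // ltnW.
rewrite /edge JE //; case: ltnP => [ltkm|lemk].
  apply: (cpath_inj (k := k) ix); have := uE k.+1; rewrite /= comp_lfunE => ->.
  by rewrite uE /z (eqP ltkm) (eqP (ltnW ltkm)).
apply: (cpath_inj (k := k.+1) ix); rewrite uE -(cpath_rel hW) // uE zS //.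
by rewrite !comp_lfunE.
Qed.

(** The edges from [m] on carry the zero of V_{n+1} leftwards to position [m]; the edges before [m]
    say that the vector at [m] is the image of [w]. *)
Lemma zigzag_neg n x J m w : (forall i, ~~ vert n i -> dimr x i = 0%N) ->
  (m <= n.+1)%N -> (forall k, J k = (m <= k)%N) ->
  zigzag x J w <-> cxpath x m w = 0.
Proof.
move=> dx lemn JE; split=> [[u [<- uE]]|w0].
  have pathE k : (k <= m)%N -> cxpath x k (u 0%N) = u k.
    elim: k => [|k IHk] ltkm; first by rewrite /= id_lfunE.
    have := uE k; rewrite /edge JE leqNgt ltkm /= => ->.
    by rewrite comp_lfunE IHk // ltnW.
  have u0 l : (l <= n.+1 - m)%N -> u (n.+1 - l)%N = 0.
    elim: l => [|l IHl] leml.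
      by rewrite subn0; apply: gr_eq; rewrite dx // /vert ltnn.
    have lel : (m <= n.+1 - l.+1)%N by lia.
    have := uE (n.+1 - l.+1)%N; rewrite /edge JE lel => ->.
    have E : (n.+1 - l.+1).+1 = (n.+1 - l)%N by lia.
    have -> : u (n.+1 - l.+1).+1 = 0 by rewrite E IHl //; lia.
    exact: linear0.
  by rewrite pathE //; have := u0 _ (leqnn _); rewrite subKn.
exists (fun k => cxpath x k w); split=> [|k]; first by rewrite /= id_lfunE.
rewrite /edge JE; case: ifP => [lemk|_]; last by rewrite /= comp_lfunE.
have path0 l : (m <= l)%N -> cxpath x l w = 0.
  move=> /subnK <-; elim: (l - m)%N => // l' IHl.
  by rewrite addSn /= comp_lfunE IHl linear0.
by rewrite !path0 ?linear0 // leqW.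
Qed.

End Zigzag.

(** * Zigzag spaces under one reflection *)

Section ReflectionChain.
Variables (C : fieldType) (W : nat -> vectType C).
Implicit Types (x : rep W) (n i k m : nat) (J : nat -> bool).
Hypothesis hW : forall i, i <> 1%N -> \dim {:W i} = 0%N.

(** One of W_i and V_{i-1} is always zero, so U_i is the sum of the two neighbours in the chain; the
    left one sits in the framing slot exactly when [i = 1]. *)
Definition chain_emb x m : chain x m -> chain x m.+2 -> U x m.+1 :=
  match m return chain x m -> chain x m.+2 -> U x m.+1 with
  | 0%N => fun w v => (w, 0, v)
  | k.+1 => fun u v => (0, u, v)
  end.

Lemma chain_emb_inj x m u v u' v' :
  @chain_emb x m u v = chain_emb u' v' -> u = u' /\ v = v'.
Proof. by case: m u v u' v' => [|m] u v u' v' /= [-> ->]. Qed.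

Lemma ra_chain x m u : dimr x 0%N = 0%N ->
  @ra C W x m.+1 u = chain_emb (cy x m u) (cx x m.+1 u).
Proof.
move=> d0; case: m u => [|m] u; congr (_, _, _); first exact: gr_eq.
exact: W_eq.
Qed.

Lemma rb_chain x m u v :
  rb (@chain_emb x m u v) = cx x m u - cy x m.+1 v.
Proof.
by case: m u v => [|m] u v; rewrite /rb /= linear0 ?addr0 ?add0r.
Qed.

(** The special role of vertex 1 is absorbed here, so that the later arguments treat all vertices
    alike. *)
Lemma reflection_chain m x x' : dimr x 0%N = 0%N -> dimr x' 0%N = 0%N ->
  reflection m.+1 x x' ->
  exists h : forall k, 'Hom(chain x k, chain x' k),
  [/\ forall w, h 0%N w = w,
      forall k, k <> m.+1 -> lbij (h k),
      forall k, k <> m.+1 -> k.+1 <> m.+1 ->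
        (forall u, cx x' k (h k u) = h k.+1 (cx x k u)) /\
        (forall u, cy x' k (h k.+1 u) = h k (cy x k u)),
      forall u v, cx x m u = cy x m.+1 v <->
        exists t, cy x' m t = h m u /\ cx x' m.+1 t = h m.+2 v &
      forall u v, let z := cx x m u - cy x m.+1 v in
        let z' := cx x' m (h m u) - cy x' m.+1 (h m.+2 v) in
        cy x' m z' = h m (cy x m z) /\ cx x' m.+1 z' = h m.+2 (cx x m.+1 z)].
Proof.
move=> d0 d0' [g]; case=> gb xyE pqE [_ exE0 _] [abE0 _].
pose h k : 'Hom(chain x k, chain x' k) :=
  match k with 0%N => \1%VF | k'.+1 => g k'.+1 end.
have h0 w : h 0%N w = w by rewrite /= id_lfunE.
pose gU (u : U x m.+1) : U x' m.+1 := (u.1.1, g m u.1.2, g m.+2 u.2).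
have gUE u v : gU (chain_emb u v) = chain_emb (h m u) (h m.+2 v).
  by rewrite /gU; case: (m) u v => [|k] u v; rewrite /= ?h0 ?id_lfunE ?linear0.
have exE u : rb u = 0 <-> exists u', ra u' = gU u by exact: exE0.
have abE u : gU (ra (rb u)) = ra (rb (gU u)) by exact: abE0.
exists h; split=> //.
- case=> [|k] nek; last exact: (gb k.+1).
  by apply/lbijP; split=> [u v|u]; [rewrite !h0 | exists u].
- case=> [|k] nek nek1; split=> u; rewrite ?h0 /=.
  + by have [-> _] := pqE 1%N nek1; rewrite comp_lfunE.
  + by have [_ <-] := pqE 1%N nek1; rewrite comp_lfunE.
  + by have [E _] := xyE k.+1 nek nek1; rewrite -comp_lfunE E comp_lfunE.
  + by have [_ E] := xyE k.+1 nek nek1; rewrite -comp_lfunE E comp_lfunE.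
- move=> u v; have := exE (chain_emb u v).
  rewrite gUE rb_chain => -[ex1 ex2].
  split=> [E|[t [tu tv]]].
    have [|t] := ex1; first by rewrite E subrr.
    by rewrite ra_chain // => /chain_emb_inj[tu tv]; exists t.
  by apply/eqP; rewrite -subr_eq0 ex2 //; exists t; rewrite ra_chain // tu tv.
- move=> u v /=; have := abE (chain_emb u v).
  rewrite gUE !rb_chain !ra_chain // gUE.
  by case/chain_emb_inj.
Qed.

(* The value of [u] at [m.+1] is replaced by one that is found from the values
   at [m] and [m.+2]. *)
Lemma zigzag_transfer x x' J J' m
    (Q : forall k, chain x k -> chain x' k -> Prop) (w w' : W 1) :
  (forall w'', @Q 0%N w w'' -> w'' = w') ->
  (forall k u, k <> m.+1 -> exists u', @Q k u u') ->
  (forall k u v u' v', k <> m.+1 -> k.+1 <> m.+1 ->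
     Q k u u' -> Q k.+1 v v' -> edge J u v -> edge J' u' v') ->
  (forall (a : chain x m) b (c : chain x m.+2) a' c', Q m a a' -> Q m.+2 c c' ->
     edge J a b -> edge J b c ->
     exists b', edge J' a' b' /\ edge (x := x') J' b' c') ->
  zigzag x J w -> zigzag x' J' w'.
Proof.
move=> Q0 Qex Qstep Qtwo [u [u0 uE]].
(* The lemma is used both along an isomorphism and against it, hence the relation [Q] and a chosen
   value. The choice at [m.+1], about which nothing is known, is overwritten below. *)
pose f k : chain x' k := xget 0 [set z | Q k (u k) z].
have fQ k : k <> m.+1 -> Q k (u k) (f k).
  move=> nek; rewrite /f; case: xgetP => // Q0'.
  by have [z Qz] := Qex k (u k) nek; case: (Q0' z).
have nem : m <> m.+1 by lia.
have nem2 : m.+2 <> m.+1 by lia.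
have [t [tE1 tE2]] := Qtwo _ _ _ _ _ (fQ _ nem) (fQ _ nem2) (uE m) (uE m.+1).
pose f' := dfwith f t.
have f'm : f' m.+1 = t by rewrite /f' dfwith_in.
have f'E k : k <> m.+1 -> f' k = f k.
  by move=> nek; rewrite /f' dfwith_out //; apply/eqP/nesym.
exists f'; split=> [|k].
  by rewrite f'E //; apply: Q0; rewrite -u0; apply: fQ.
have [->|nek] := pselect (k = m.+1); first by rewrite f'm f'E.
have [E|nek1] := pselect (k.+1 = m.+1).
  by case: E => ->; rewrite f'm f'E.
by rewrite !f'E //; apply: Qstep (fQ _ nek) (fQ _ nek1) (uE k).
Qed.

(** Two edges of the same kind compose to a product of two [cy] or two [cx], which is an entry of
    a_i b_i up to sign and is therefore preserved. The remaining mixed pattern is where exactness is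
    used. *)
Lemma reflection_zigzag i x x' J w : (0 < i)%N ->
  dimr x 0%N = 0%N -> dimr x' 0%N = 0%N ->
  reflection i x x' -> (J i.-1 -> J i) ->
  zigzag x J w <-> zigzag x' (J \o transp i.-1 i) w.
Proof.
case: i => // m _ d0 d0' /(reflection_chain d0 d0') [h [h0 hb hE hex hab]] /= JE.
have Jm : transp m m.+1 m = m.+1 by rewrite /transp eqxx.
have Jm1 : transp m m.+1 m.+1 = m.
  by rewrite /transp; do !case: eqP => //; lia.
have Jk k : k <> m -> k <> m.+1 -> transp m m.+1 k = k.
  by rewrite /transp; do !case: eqP.
have inj_h k : k <> m.+1 -> injective (h k) by move=> /hb /lbijP[].
have nem : m <> m.+1 by lia.
have nem2 : m.+2 <> m.+1 by lia.
have xxE u : h m.+2 (cx x m.+1 (cx x m u)) = cx x' m.+1 (cx x' m (h m u)).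
  by have [_] := hab u 0; rewrite !linear0 !addr0 => ->.
have yyE v : h m (cy x m (cy x m.+1 v)) = cy x' m (cy x' m.+1 (h m.+2 v)).
  have [+ _] := hab 0 v; rewrite !linear0 !sub0r !linearN => /oppr_inj ->.
  by [].
split.
- apply: (zigzag_transfer (m := m) (Q := fun k u u' => u' = h k u)).
  + by move=> _ ->; rewrite h0.
  + by move=> k u _; exists (h k u).
  + move=> k u v _ _ nek nek1 -> ->; have [hx hy] := hE k nek nek1.
    rewrite /edge /= Jk //; last by move=> E; apply: nek1; rewrite E.
    by case: ifP => _ ->.
  + move=> a b c _ _ -> ->; rewrite /edge /= Jm Jm1.
    case Jm0: (J m); first rewrite JE //.
      by move=> -> ->; rewrite yyE; exists (cy x' m.+1 (h m.+2 c)).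
    case: ifP => _ -> E.
      have [t [t1 t2]] := (hex a c).1 E; by exists t; rewrite t1 t2.
    by rewrite E xxE; exists (cx x' m (h m a)).
- apply: (zigzag_transfer (m := m) (Q := fun k u' u => u' = h k u)).
  + by move=> w' ->; rewrite h0.
  + move=> k u nek; have /lbijP[_ /(_ u)[u' <-]] := hb k nek.
    by exists u'.
  + move=> k _ _ u v nek nek1 -> ->; have [hx hy] := hE k nek nek1.
    rewrite /edge /= Jk //; last by move=> E; apply: nek1; rewrite E.
    case: ifP => _; first by rewrite hy => /(inj_h _ nek).
    by rewrite hx => /(inj_h _ nek1).
  + move=> _ b _ a c -> ->; rewrite /edge /= Jm Jm1.
    case Jm0: (J m); first rewrite JE //.
      move=> E1 E2; exists (cy x m.+1 c); split=> //.
      by apply: (inj_h m nem); rewrite yyE -E2.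
    case: ifP => _ E1 E2.
      by exists (cx x m a); split=> //; apply/hex; exists b.
    exists (cx x m a); split=> //.
    by apply: (inj_h m.+2 nem2); rewrite xxE E2 E1.
Qed.

(** For [i = 1] this is the entry of a_i b_i from [W] to [W]; for other [i] the maps p_1 and q_1
    change only by an isomorphism of V_1. *)
Lemma reflection_qp i x x' : (0 < i)%N ->
  dimr x 0%N = 0%N -> dimr x' 0%N = 0%N -> reflection i x x' ->
  (cy x' 0 \o cx x' 0)%VF = (cy x 0 \o cx x 0)%VF.
Proof.
case: i => // m _ d0 d0' /(reflection_chain d0 d0') [h [h0 _ hE _ hab]].
apply/lfunP => w; rewrite !comp_lfunE; case: m h h0 hE hab => [|m] h h0 hE hab.
  by have [+ _] := hab w 0; rewrite !linear0 !addr0 !h0.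
have [//|//|hx hy] := hE 0%N.
by rewrite -[in LHS](h0 w) hx hy h0.
Qed.

End ReflectionChain.

(** * Reflections preserve semistability *)

Section ReflectionSemistable.
Variables (C : fieldType) (W : nat -> vectType C).
Implicit Types (x : rep W) (n i k m : nat) (xi v d : nat -> int).

Lemma dotw_upd n i xi d d' : vert n i ->
  (forall j, vert n j -> j <> i -> d j = d' j) ->
  dotw n xi d' = dotw n xi d + xi i * (d' i - d i).
Proof.
move=> vi dE; have iI : i \in index_iota 1 n.+1 by rewrite mem_index_iota.
rewrite /dotw (bigD1_seq i) ?iota_uniq //= [in RHS](bigD1_seq i) ?iota_uniq //=.
have -> : \sum_(1 <= j < n.+1 | j != i) xi j * d' j
    = \sum_(1 <= j < n.+1 | j != i) xi j * d j.
  rewrite big_nat_cond [RHS]big_nat_cond; apply: eq_bigr => j /andP[vj /eqP ji].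
  by rewrite dE.
by rewrite addrAC -mulrDr; congr (_ * _ + _); lia.
Qed.

(** The bracket compares the two dimensions at [i] with those of the neighbours, which is what an
    exact sequence through U_i controls. *)
Lemma dotw_srefl_upd n i xi d d' : vert n i ->
  (forall j, vert n j -> j <> i -> d j = d' j) ->
  dotw n (srefl i xi) d'
    = dotw n xi d + xi i * (ext n d' i.-1 + ext n d' i.+1 - d' i - d i).
Proof.
move=> vi dE; rewrite dotw_srefl // (dotw_upd xi vi dE).
by rewrite -addrA -mulrDr; congr (_ + _ * _); lia.
Qed.

Lemma rb_linear x i : linear (@rb C W x i).
Proof.
move=> a u u'; rewrite /rb /= !linearP !scalerDr [RHS]addrACA.
by rewrite [X in _ = X + _]addrACA.
Qed.

Lemma ra_linear x i : linear (@ra C W x i).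
Proof. by move=> a u u'; rewrite /ra !linearP. Qed.

Definition rbl x i : 'Hom(U x i, gr C (dimr x) i) := linfun (@rb C W x i).
Definition ral x i : 'Hom(gr C (dimr x) i, U x i) := linfun (@ra C W x i).

Lemma rblE x i u : rbl x i u = rb u.
Proof. exact/linfun_linE/rb_linear. Qed.

Lemma ralE x i u : ral x i u = ra u.
Proof. exact/linfun_linE/ra_linear. Qed.

Lemma lbij_preim (V V' : vectType C) (f : 'Hom(V, V')) (S : {vspace V'}) :
  lbij f -> \dim (f @^-1: S)%VS = \dim S.
Proof.
move=> fb; have [kf lf] := fb; rewrite -[in RHS](lpreimK (f := f) (W := S)).
  by rewrite limg_dim_eq // kf capv0.
by rewrite lf subvf.
Qed.

Lemma dim_limg_le (V V' : vectType C) (f : 'Hom(V, V')) (S : {vspace V}) :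
  (\dim (f @: S) <= \dim S)%N.
Proof. by rewrite -[leqRHS](limg_ker_dim f) leq_addl. Qed.

Lemma memv_imgS (V V' : vectType C) (f : 'Hom(V, V')) (X : {vspace V})
    (Y : {vspace V'}) u : (f @: X <= Y)%VS -> u \in X -> f u \in Y.
Proof. by move=> /subvP fXY uX; apply/fXY/memv_img. Qed.

(* The subspace at the vertex [m.+1] is the image under [rb] of the sum of the
   subspaces at the neighbours. *)
Lemma reflection_subspace m x x' (S' : forall j, {vspace gr C (dimr x') j})
    (A : forall j, {vspace W j}) :
  reflection m.+1 x x' -> stable S' ->
  (forall j, (rq x' j @: S' j <= A j)%VS) ->
  (forall j, (rp x' j @: A j <= S' j)%VS) ->
  exists S : forall j, {vspace gr C (dimr x) j},
    [/\ stable S, forall j, (rq x j @: S j <= A j)%VS,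
        forall j, (rp x j @: A j <= S j)%VS,
        forall j, j <> m.+1 -> \dim (S j) = \dim (S' j) &
        (\dim (S m.+1) + \dim (S' m.+1)
           <= \dim (A m.+1) + \dim (S' m) + \dim (S' m.+2))%N].
Proof.
case=> g; case=> gb xyE pqE [ra_inj exE0 _] [abE0 _] stS' qS' pS'.
pose gU (u : U x m.+1) : U x' m.+1 := (u.1.1, g m u.1.2, g m.+2 u.2).
have exE u : rb u = 0 <-> exists u', ra u' = gU u by exact: exE0.
have abE u : gU (ra (rb u)) = ra (rb (gU u)) by exact: abE0.
have nem : m <> m.+1 by lia.
have nem2 : m.+2 <> m.+1 by lia.
pose P j : {vspace gr C (dimr x) j} := (g j @^-1: S' j)%VS.
have memP j u : (u \in P j) = (g j u \in S' j) by rewrite -memv_preim.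
pose SU j : {vspace U x j} := prodv (prodv (A j) (P j.-1)) (P j.+1).
pose S j : {vspace gr C (dimr x) j} :=
  if j == m.+1 then (rbl x j @: SU j)%VS else P j.
have Sm : S m.+1 = (rbl x m.+1 @: SU m.+1)%VS by rewrite /S eqxx.
have SE j : j <> m.+1 -> S j = P j by rewrite /S => /eqP/negbTE ->.
have memSU (u : U x m.+1) : (u \in SU m.+1) =
    [&& u.1.1 \in A m.+1, g m u.1.2 \in S' m & g m.+2 u.2 \in S' m.+2].
  by rewrite !mem_prodv !memP -andbA.
(* The equality of a_i b_i for both points leads through [S'], whose stability brings the result
   back to the neighbours. *)
have raS (z : gr C (dimr x) m.+1) : z \in S m.+1 -> ra z \in SU m.+1.
  rewrite Sm => /memv_imgP[u + ->]; rewrite rblE memSU => /and3P[uA uP uQ].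
  have : rb (gU u) \in S' m.+1.
    rewrite /rb /= rpredB // ?rpredD //.
    - exact: memv_imgS (pS' _) uA.
    - exact: memv_imgS (stS' m).1 uP.
    - exact: memv_imgS (stS' m.+1).2 uQ.
  move=> bS'; have := abE u; rewrite memSU /= => -[-> -> ->]; apply/and3P; split.
  - exact: memv_imgS (qS' _) bS'.
  - exact: memv_imgS (stS' m).2 bS'.
  - exact: memv_imgS (stS' m.+1).1 bS'.
have rbS (u : U x m.+1) : u \in SU m.+1 -> rb u \in S m.+1.
  by move=> uS; rewrite Sm -rblE memv_img.
exists S; split.
- move=> j; have [->|nej] := pselect (j = m.+1).
    split; apply/subvP => _ /memv_imgP[z zS ->].
      by rewrite SE // memP; have := raS z zS; rewrite memSU => /and3P[].
    rewrite (_ : ry x m.+1 z = rb ((0, 0, - z) : U x m.+1)).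
      apply: rbS; rewrite memSU /= linear0 !mem0v linearN rpredN -memP.
      by rewrite -SE.
    by rewrite /rb /= !linear0 linearN opprK !add0r.
  have [/succn_inj->|nej1] := pselect (j.+1 = m.+1).
    split; apply/subvP => _ /memv_imgP[z zS ->].
      rewrite (_ : rx x m z = rb ((0, z, 0) : U x m.+1)).
        apply: rbS; rewrite memSU /= linear0 !mem0v -memP.
        by rewrite -SE // zS.
      by rewrite /rb /= !linear0 addr0 add0r.
    by rewrite SE // memP; have := raS z zS; rewrite memSU => /and3P[].
  have [xE yE] := xyE j nej nej1.
  rewrite !SE //; split; apply/subvP => _ /memv_imgP[z + ->]; rewrite !memP.
    rewrite -[g _ (rx _ _ _)]comp_lfunE -xE comp_lfunE.
    exact: memv_imgS (stS' j).1.
  rewrite -[g _ (ry _ _ _)]comp_lfunE -yE comp_lfunE.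
  exact: memv_imgS (stS' j).2.
- move=> j; apply/subvP => _ /memv_imgP[z + ->].
  have [E|nej] := pselect (j = m.+1).
    by move: z; rewrite E => z /raS; rewrite memSU => /and3P[].
  have [_ qE] := pqE j nej; rewrite SE // memP -qE comp_lfunE.
  exact: memv_imgS.
- move=> j; apply/subvP => _ /memv_imgP[z zA ->].
  have [E|nej] := pselect (j = m.+1).
    move: z zA; rewrite E => z zA.
    rewrite (_ : rp x m.+1 z = rb ((z, 0, 0) : U x m.+1)).
      by apply: rbS; rewrite memSU /= !linear0 !mem0v zA.
    by rewrite /rb /= !linear0 !addr0.
  have [pE _] := pqE j nej; rewrite SE // memP -[g _ _]comp_lfunE -pE.
  exact: memv_imgS zA.
- by move=> j nej; rewrite SE // lbij_preim //; apply: gb.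
pose gUl : 'Hom(U x m.+1, U x' m.+1) := linfun gU.
have gUE u : gUl u = gU u.
  by apply: linfun_linE => a y z; rewrite /gU /= !linearP.
(* By exactness a_i(x') embeds [S' m.+1] into the kernel of b_i(x) on the chosen sum; the bound is
   then the rank formula. *)
have dimK : (\dim (S' m.+1) <= \dim (SU m.+1 :&: lker (rbl x m.+1)))%N.
  apply: leq_trans (dim_limg_le gUl _).
  rewrite -(limg_dim_eq (f := ral x' m.+1)); last first.
    rewrite (_ : lker _ = 0%VS) ?capv0 //; apply/eqP/lker0P => y z.
    by rewrite !ralE; apply: ra_inj.
  apply: dimvS; apply/subvP => _ /memv_imgP[t tS ->]; rewrite ralE.
  have /lbijP[_ /(_ (rym x' m.+1 t))[a aE]] := gb m nem.
  have /lbijP[_ /(_ (rx x' m.+1 t))[b bE]] := gb m.+2 nem2.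
  have tE : ra t = gU (rq x' m.+1 t, a, b) by rewrite /ra /gU /= aE bE.
  apply/memv_imgP; exists (rq x' m.+1 t, a, b); last by rewrite gUE.
  rewrite memv_cap memv_ker rblE memSU /= aE bE; apply/andP; split; last first.
    by apply/eqP/exE; exists t.
  apply/and3P; split.
  - exact: memv_imgS (qS' _) tS.
  - exact: memv_imgS (stS' m).2 tS.
  - exact: memv_imgS (stS' m.+1).1 tS.
have := limg_ker_dim (rbl x m.+1) (SU m.+1); rewrite -Sm !dim_prodv.
rewrite !lbij_preim; [|exact: gb|exact: gb] => <-.
by rewrite addnC leq_add2r.
Qed.

Lemma reflection_semistable n i xi v x x' : vert n i -> xi i < 0 ->
  dim_is n x v -> dim_is n x' (star n (fun i => \dim {:W i}) i v) ->
  reflection i x x' -> semistable n xi x -> semistable n (srefl i xi) x'.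
Proof.
move=> vi xi_lt0 dx dx' refl [ss1 ss2].
have extE (S : forall j, {vspace gr C (dimr x') j}) k :
    ext n (fun j => (\dim (S j))%:Z) k = (\dim (S k))%:Z.
  rewrite /ext; case: ifPn => // nvk.
  have : (\dim (S k) <= \dim {:gr C (dimr x') k})%N by apply/dimvS/subvf.
  by rewrite dim_gr (dim_is0 dx' nvk) leqn0 => /eqP ->.
case: i vi xi_lt0 dx' refl => // m vi xi_lt0 dx' refl.
(* Both conditions at once: [A] is zero for (S1) and all of [W] for (S2). As [xi m.+1] is negative,
   the upper bound on dimensions becomes the inequality wanted. *)
have key (S' : forall j, {vspace gr C (dimr x') j}) (A : forall j, {vspace W j}) :
    stable S' -> (forall j, (rq x' j @: S' j <= A j)%VS) ->
    (forall j, (rp x' j @: A j <= S' j)%VS) ->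
    exists S : forall j, {vspace gr C (dimr x) j},
    [/\ stable S, forall j, (rq x j @: S j <= A j)%VS,
        forall j, (rp x j @: A j <= S j)%VS &
    dotw n (srefl m.+1 xi) (fun j => (\dim (S' j))%:Z) <=
    dotw n xi (fun j => (\dim (S j))%:Z) - xi m.+1 * (\dim (A m.+1))%:Z].
  move=> st qS pS.
  have [S [stS qS' pS' dimS dimSm]] := reflection_subspace refl st qS pS.
  exists S; split=> //.
  rewrite (@dotw_srefl_upd n m.+1 xi (fun j => (\dim (S j))%:Z)) //; last first.
    by move=> j _ nej; rewrite dimS.
  rewrite lerD2l -mulrN; apply: ler_wnM2l; first exact: ltW.
  by rewrite !extE /=; lia.
split=> [S' st Sq|T' st pT].
  have [|j|S [stS qS _ /le_trans ->//]] := key S' (fun=> 0%VS) st.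
  - by move=> j; rewrite subv0 -lkerE.
  - by rewrite limg0 sub0v.
  - rewrite dimv0 mulr0 subr0; apply: ss1 => // j.
    by rewrite lkerE -subv0.
have [j|j|T [stT _ pT' /le_trans ->//]] := key T' (fun=> fullv) st.
- exact: subvf.
- exact: pT.
(* The full spaces attain the dimension bound, so the term in [W] appears on both sides and
   cancels. *)
rewrite (@dotw_srefl_upd n m.+1 xi (fun j => (dimr x j)%:Z)) //; last first.
  by move=> j vj nej; rewrite dx dx' vj /star; case: eqP.
have -> : ext n (fun j => (dimr x' j)%:Z) m + ext n (fun j => (dimr x' j)%:Z) m.+2
    - (dimr x' m.+1)%:Z - (dimr x m.+1)%:Z = - (\dim {:W m.+1})%:Z.
  have extd k : k <> m.+1 -> ext n (fun j => (dimr x' j)%:Z) k = ext n v k.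
    move=> nek; rewrite /ext; case: ifP => // vk.
    by rewrite dx' vk /star; case: eqP.
  rewrite !extd; [|lia|lia]; rewrite dx dx' vi starE //=; lia.
by rewrite mulrN lerD2r; apply: ss2.
Qed.

End ReflectionSemistable.

(** * Existence of the reflected point *)

Section ReflectionExists.
Variables (C : fieldType) (W : nat -> vectType C).
Implicit Types (x : rep W) (n i k m : nat) (xi v d : nat -> int).

(** Shrinking V_i to the image of b_i leaves a stable subspace containing the image of [p]; with a
    negative weight at [i], (S2) forbids any loss of dimension. *)
Lemma semistable_rb_surj n i xi v x : vert n i -> xi i < 0 ->
  semistable_locus n xi v x -> limg (rbl x i) = fullv.
Proof.
move=> vi xi_lt0 [dx mx [_ ss]].
pose T j : {vspace gr C (dimr x) j} := if j == i then limg (rbl x j) else fullv.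
have TE j : j <> i -> T j = fullv by rewrite /T => /eqP/negbTE ->.
have rbT (u : U x i) : rb u \in T i by rewrite /T eqxx -rblE memv_img ?memvf.
have stT : stable T.
  move=> j; split; apply/subvP => _ /memv_imgP[z _ ->].
    have [E|nej] := pselect (j.+1 = i); last by rewrite TE ?memvf.
    move: rbT; rewrite -E => /(_ (0, z, 0)).
    by rewrite /rb /= !linear0 addr0 add0r.
  have [E|nej] := pselect (j = i); last by rewrite TE ?memvf.
  move: rbT; rewrite -E => /(_ (0, 0, - z)).
  by rewrite /rb /= !linear0 linearN opprK !add0r.
have pT j : (limg (rp x j) <= T j)%VS.
  apply/subvP => _ /memv_imgP[z _ ->].
  have [E|nej] := pselect (j = i); last by rewrite TE ?memvf.
  move: rbT; rewrite -E => /(_ (z, 0, 0)).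
  by rewrite /rb /= !linear0 !addr0.
have := ss T stT pT.
rewrite (dotw_upd (d := fun j => (dimr x j)%:Z)
  (d' := fun j => (\dim (T j))%:Z) xi vi).
  rewrite gerDl nmulr_rle0 // subr_ge0 lez_nat /T eqxx => le_d.
  by apply/eqP; rewrite eqEdim subvf dim_gr.
by move=> j vj nej; rewrite TE // dim_gr.
Qed.

Lemma rb_ra x i u : mu x i = 0 -> rb (@ra C W x i u) = 0.
Proof.
move=> mu0; have := muE u; rewrite mu0 lfunE /= => /esym/eqP.
by rewrite subr_eq0 => /eqP E; rewrite /rb /= -E subrK subrr.
Qed.

Lemma dim_U x i : \dim {:U x i} = (\dim {:W i} + dimr x i.-1 + dimr x i.+1)%N.
Proof.
have -> : fullv = prodv
    (prodv (fullv : {vspace W i}) (fullv : {vspace gr C (dimr x) i.-1}))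
    (fullv : {vspace gr C (dimr x) i.+1}).
  by apply/vspaceP => u; rewrite !mem_prodv !memvf.
by rewrite !dim_prodv !dim_gr.
Qed.

Section Construction.
Variables (x : rep W) (m : nat).
Local Notation i := m.+1.
Hypothesis mx : forall j, mu x j = 0.
Hypothesis rb_surj : limg (rbl x i) = fullv.

Let d j := if j == i then \dim (lker (rbl x i)) else dimr x j.
Let emb j : 'Hom(gr C d j, U x j) := basmap (lker (rbl x j)) (d j).
Let to j : 'Hom(gr C (dimr x) j, gr C d j) := resize C (dimr x j) (d j).
Let from j : 'Hom(gr C d j, gr C (dimr x) j) := resize C (d j) (dimr x j).
Let beta j : 'Hom(U x j, gr C d j) := ((emb j)^-1 \o ral x j \o rbl x j)%VF.

Let in1 j : 'Hom(W j, U x j) := linfun (fun w => (w, 0, 0)).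
Let in2 j : 'Hom(gr C (dimr x) j.-1, U x j) := linfun (fun u => (0, u, 0)).
Let in3 j : 'Hom(gr C (dimr x) j.+1, U x j) := linfun (fun u => (0, 0, u)).
Let pr1 j : 'Hom(U x j, W j) := linfun (fun u => u.1.1).
Let pr2 j : 'Hom(U x j, gr C (dimr x) j.-1) := linfun (fun u => u.1.2).
Let pr3 j : 'Hom(U x j, gr C (dimr x) j.+1) := linfun (fun u => u.2).

Let in1E j w : in1 j w = (w, 0, 0).
Proof.
by apply: linfun_linE => a y z; congr (_, _, _); rewrite /= scaler0 addr0.
Qed.

Let in2E j w : in2 j w = (0, w, 0).
Proof.
by apply: linfun_linE => a y z; congr (_, _, _); rewrite /= scaler0 addr0.
Qed.

Let in3E j w : in3 j w = (0, 0, w).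
Proof.
by apply: linfun_linE => a y z; congr (_, _, _); rewrite /= scaler0 addr0.
Qed.

Let pr1E j u : pr1 j u = u.1.1. Proof. exact: linfun_linE. Qed.
Let pr2E j u : pr2 j u = u.1.2. Proof. exact: linfun_linE. Qed.
Let pr3E j u : pr3 j u = u.2. Proof. exact: linfun_linE. Qed.

(** V_i' is the kernel of b_i(x) in coordinates, a_i is its inclusion, and b_i is a_i(x) b_i(x),
    which lands in the kernel. The sign in [ry] undoes the one in [rb]. Away from [i] the maps [to]
    and [from] replace casts. *)
Definition reflected_rep : rep W := @Rep C W d
  (fun j => if j == i then to j.+1 \o pr3 j \o emb j
            else if j.+1 == i then beta j.+1 \o in2 j.+1 \o from j
            else to j.+1 \o rx x j \o from j)%VF
  (fun j => if j.+1 == i then to j \o pr2 j.+1 \o emb j.+1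
            else if j == i then - (beta j \o in3 j \o from j.+1)
            else to j \o ry x j \o from j.+1)%VF
  (fun j => if j == i then beta j \o in1 j else to j \o rp x j)%VF
  (fun j => if j == i then pr1 j \o emb j else rq x j \o from j)%VF.

Local Notation x' := reflected_rep.

Let dE j : j <> i -> dimr x j = d j.
Proof. by rewrite /d => /eqP/negbTE ->. Qed.

Let toK j : j <> i -> cancel (to j) (from j).
Proof. by move=> /dE E; apply: resizeK. Qed.

Let to_lbij j : j <> i -> lbij (to j).
Proof.
move=> nej; apply/lbijP; split; first exact/can_inj/toK.
by move=> u; exists (from j u); apply: resizeK; rewrite dE.
Qed.

Let di : d i = \dim (lker (rbl x i)). Proof. by rewrite /d eqxx. Qed.

Let emb_inj : injective (emb i).
Proof. by have [] := basmapP di. Qed.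

Let emb_im : limg (emb i) = lker (rbl x i).
Proof. by have [] := basmapP di. Qed.

Let nem : m <> i. Proof. lia. Qed.
Let nem2 : m.+2 <> i. Proof. lia. Qed.

Let gU (u : U x i) : U x' i := (u.1.1, to m u.1.2, to m.+2 u.2).

Let raE u : ra (u : gr C (dimr x') i) = gU (emb i u).
Proof.
rewrite /ra /gU /= !eqxx !comp_lfunE pr1E.
by congr (_, _, _); rewrite ?pr2E ?pr3E.
Qed.

Let rb_p w : rp x' i w = beta i (in1 i w).
Proof. by rewrite /= eqxx comp_lfunE. Qed.

Let rb_x u : rx x' m u = beta i (in2 i (from m u)).
Proof. by rewrite /= eqxx (negbTE (introN eqP nem)) !comp_lfunE. Qed.

Let rb_y u : ry x' i u = - beta i (in3 i (from m.+2 u)).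
Proof.
by rewrite /= eqxx (negbTE (introN eqP nem2)) opp_lfunE !comp_lfunE.
Qed.

Let rbE u : rb (gU u) = beta i u.
Proof.
have -> : rb (gU u)
    = rp x' i u.1.1 + rx x' m (to m u.1.2) - ry x' i (to m.+2 u.2).
  by [].
rewrite rb_p rb_x rb_y !toK // opprK -!linearD; congr (beta i _).
rewrite in1E in2E in3E; case: u => [[a b] c] /=.
by congr (_, _, _); rewrite /= ?addr0 ?add0r.
Qed.

Let abE u : gU (ra (rb u)) = ra (rb (gU u)).
Proof.
rewrite raE rbE; congr gU; rewrite !comp_lfunE limg_lfunVK ?ralE ?rblE //.
by rewrite emb_im memv_ker rblE rb_ra.
Qed.

Let xE j u : j <> i -> j.+1 <> i -> rx x' j (to j u) = to j.+1 (rx x j u).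
Proof.
move=> nej nej1; rewrite /= (negbTE (introN eqP nej)) (negbTE (introN eqP nej1)).
by rewrite !comp_lfunE toK.
Qed.

Let yE j u : j <> i -> j.+1 <> i -> ry x' j (to j.+1 u) = to j (ry x j u).
Proof.
move=> nej nej1; rewrite /= (negbTE (introN eqP nej)) (negbTE (introN eqP nej1)).
by rewrite !comp_lfunE toK.
Qed.

Let pE j u : j <> i -> rp x' j u = to j (rp x j u).
Proof. by move=> nej; rewrite /= (negbTE (introN eqP nej)) comp_lfunE. Qed.

Let qE j u : j <> i -> rq x' j (to j u) = rq x j u.
Proof. by move=> nej; rewrite /= (negbTE (introN eqP nej)) comp_lfunE toK. Qed.

Let yxE j u : j <> i -> ry x' j (rx x' j (to j u)) = to j (ry x j (rx x j u)).
Proof.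
move=> nej; have [E|nej1] := pselect (j.+1 = i); last by rewrite xE // yE.
move: nej u; case: E => -> _ u.
have [_ + _] := abE (0, u, 0); rewrite /rb /= !linear0 !add0r !addr0.
by move=> ->.
Qed.

Let xyE j u : j.+1 <> i ->
  rx x' j (ry x' j (to j.+1 u)) = to j.+1 (rx x j (ry x j u)).
Proof.
move=> nej1; have [E|nej] := pselect (j = i); last by rewrite yE // xE.
move: nej1 u; rewrite E => _ u.
have [_ _ +] := abE (0, 0, - u); rewrite /rb /= !linear0 !add0r !linearN !opprK.
by move=> ->.
Qed.

(** At [i] because b_i(x) vanishes on its kernel; at the neighbours because the loops through [i]
    are entries of a_i b_i. *)
Lemma reflected_mu j : mu x' j = 0.
Proof.
have [E|nej] := pselect (j = i).
  rewrite E; apply/lfunP => u.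
  have : rb (ra (u : gr C (dimr x') i)) = 0.
    rewrite raE rbE !comp_lfunE.
    have : emb i u \in lker (rbl x i) by rewrite -emb_im memv_img ?memvf.
    by rewrite memv_ker => /eqP ->; rewrite !linear0.
  rewrite muE lfunE /rb [LHS]/= => /eqP; rewrite subr_eq0 => /eqP <-.
  by rewrite addrK subrr.
apply/lfunP => u'; have /lbijP[_ /(_ u')[u <-]] := to_lbij nej.
transitivity (to j (mu x j u)); last by rewrite mx !zero_lfunE linear0.
rewrite muE [in RHS]muE yxE // pE // qE // !linearB /=.
congr (_ - _ - _); case: j nej u {u'} => [|j] nej u.
  by rewrite /= !zero_lfunE linear0.
exact: xyE.
Qed.

Lemma reflected_reflection : reflection i x x'.
Proof.
exists to; split.
- exact: to_lbij.
- by move=> j nej nej1; split; apply/lfunP => u; rewrite !comp_lfunE ?xE ?yE.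
- by move=> j nej; split; apply/lfunP => u; rewrite !comp_lfunE ?pE ?qE.
- split.
  + move=> u v; rewrite !raE /gU => -[E1 E2 E3]; apply: emb_inj.
    move: E2 E3 => /(can_inj (toK nem)) E2 /(can_inj (toK nem2)) E3.
    by move: (emb i u) (emb i v) E1 E2 E3 => [[a b] c] [[a' b'] c'] /= -> -> ->.
  + move=> u; split=> [u0|[u' +]].
      have : u \in limg (emb i) by rewrite emb_im memv_ker rblE u0.
      by case/memv_imgP => u' _ ->; exists u'; rewrite raE.
    rewrite raE /gU => -[E1 E2 E3].
    move: E2 E3 => /(can_inj (toK nem)) E2 /(can_inj (toK nem2)) E3.
    have <- : emb i u' = u.
      by move: (emb i u') u E1 E2 E3 => [[a b] c] [[a' b'] c'] /= -> -> ->.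
    apply/eqP; rewrite -rblE -memv_ker -emb_im memv_img ?memvf //.
  + move=> u; have : u \in limg (rbl x i) by rewrite rb_surj memvf.
    by case/memv_imgP => u0 _ ->; exists u0; rewrite rblE.
split; first exact: abE.
by move=> j _; split; [exact: mx | exact: reflected_mu].
Qed.

Lemma reflected_dim n v : vert n i -> dim_is n x v ->
  dim_is n x' (star n (fun j => \dim {:W j}) i v).
Proof.
move=> vi dx j; have [->|nej] := pselect (j = i); last first.
  rewrite -[dimr x' j]/(d j) -dE // dx; case: ifP => // _.
  by rewrite /star; case: eqP.
have := limg_ker_dim (rbl x i) fullv; rewrite rb_surj capfv dim_gr dim_U.
rewrite -[dimr x' i]/(d i) di vi starE // => E.
have extE k : ext n v k = (dimr x k)%:Z by rewrite dx.
rewrite !extE; have := dx i; rewrite vi => <-; move: E => /=; lia.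
Qed.

End Construction.

Lemma reflection_exists n i xi v x : vert n i -> xi i < 0 ->
  semistable_locus n xi v x ->
  exists x', semistable_locus n (srefl i xi)
    (star n (fun j => \dim {:W j}) i v) x'
    /\ reflection i x x'.
Proof.
case: i => // m vi xi_lt0 xM; have surj := semistable_rb_surj vi xi_lt0 xM.
have [dx mx ss] := xM; exists (reflected_rep x m).
have dx' := reflected_dim surj vi dx.
have refl := reflected_reflection mx surj.
split=> //; split=> //; first exact: reflected_mu.
exact: reflection_semistable dx dx' refl ss.
Qed.

End ReflectionExists.

(** * The map sigma1 and its inverse *)

Section Involution.
Variables (C : fieldType) (W : vectType C) (n : nat).
Implicit Types (B : {biscalar W}) (v : nat -> int).

Lemma sigma1K B : nondeg B ->
  cancel (@sigma1 C W n B) (@sigma1 C W n (flip_form B)).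
Proof.
move=> nB [X F]; rewrite /sigma1 /=; congr (_, _).
  rewrite -[X in radj _ _ X]sub0r radjB; last exact: flip_nondeg.
  by rewrite radj_flip // radj0 ?sub0r ?opprK //; exact: flip_nondeg.
by apply/ffunP => i; rewrite !ffunE rev_ordK perpK.
Qed.

Lemma sigma1VK B : nondeg B ->
  cancel (@sigma1 C W n (flip_form B)) (@sigma1 C W n B).
Proof.
move=> nB [X F]; rewrite /sigma1 /=; congr (_, _).
  by rewrite -[X in radj _ _ X]sub0r radjB // flip_radj // radj0 // sub0r opprK.
by apply/ffunP => i; rewrite !ffunE rev_ordK perpVK.
Qed.

Lemma sigma1_Tflagvar B v xF : nondeg B -> Tflagvar W n v xF ->
  Tflagvar W n (fun k => (\dim {:W})%:Z - v (n.+1 - k)%N) (sigma1 B xF).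
Proof.
case: xF => X F nB [[/= F0 Fn FS Fdim] XF]; split=> /=.
  split.
  - rewrite ffunE (_ : rev_ord ord0 = ord_max) ?Fn ?perp0 //.
    by apply: val_inj; rewrite /= subn1.
  - rewrite ffunE (_ : rev_ord ord_max = ord0) ?F0 ?perpf //.
    by apply: val_inj; rewrite /= subnn.
  - by move=> i j leij; rewrite !ffunE; apply/perpS/FS; rewrite leq_sub2l.
  - move=> i vi; rewrite ffunE; have := dim_perp (F (rev_ord i)) nB.
    have vr : vert n (rev_ord i) by move: vi; rewrite /vert /=; lia.
    have -> : (n.+1 - i)%N = rev_ord i by rewrite /= subSS.
    by rewrite -Fdim //; lia.
move=> i j ij; rewrite !ffunE; apply/subvP => _ /memv_imgP[u /memv_perp uF ->].
rewrite opp_lfunE memvN; apply/memv_perp => e eF; rewrite -radjP //; apply: uF.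
have rij : rev_ord i = (rev_ord j).+1 :> nat.
  by have := ltn_ord j; rewrite /= ij; lia.
exact: memv_imgS (XF _ _ rij) eF.
Qed.

Lemma eq_Tflagvar v v' : (forall i, vert n i -> v i = v' i) ->
  Tflagvar W n v = Tflagvar W n v'.
Proof.
by move=> vE; apply/seteqP; split=> -[X F] [[/= ? ? ? Fdim] XF]; split=> //;
  split=> // i vi; rewrite Fdim // vE.
Qed.

End Involution.

(** * Reduced words applied to orbits *)

Section Orbits.
Variables (C : fieldType) (W : nat -> vectType C).
Implicit Types (x : rep W) (n i k m : nat) (xi v : nat -> int).
Hypothesis hW : forall i, i <> 1%N -> \dim {:W i} = 0%N.

Lemma eq_locus n xi xi' v : (forall i, vert n i -> xi i = xi' i) ->
  semistable_locus (W := W) n xi v = semistable_locus n xi' v.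
Proof.
move=> xiE; have dotE d : dotw n xi d = dotw n xi' d by apply: eq_dotw.
by apply/seteqP; split=> x [dx mx [ss1 ss2]]; split=> //; split=> S stS hS;
  [rewrite -dotE|rewrite -!dotE|rewrite dotE|rewrite !dotE]; auto.
Qed.

Lemma locus_dim0 n xi v x : semistable_locus n xi v x -> dimr x 0%N = 0%N.
Proof. by case=> dx _ _; apply: dim_is0 dx _. Qed.

Lemma pos_locus_orbit n xi v x x' : (forall i, vert n i -> 0 < xi i) ->
  semistable_locus n xi v x -> same_orbit x x' -> semistable_locus n xi v x'.
Proof.
move=> xi0 /(pos_locusP hW _ _ xi0) [dx mx ix] xx'; have [g [gb gE]] := xx'.
have gS i u : exists u', g i u' = u by have /lbijP[_] := gb i.
have gI i : injective (g i) by have /lbijP[] := gb i.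
have dE i : dimr x' i = dimr x i by rewrite -!(dim_gr C) (lbij_dim (gb i)).
have xE i u : rx x' i (g i u) = g i.+1 (rx x i u).
  by have [E _ _ _] := gE i; rewrite -!comp_lfunE E.
have yE i u : ry x' i (g i.+1 u) = g i (ry x i u).
  by have [_ E _ _] := gE i; rewrite -!comp_lfunE E.
have pE i u : rp x' i u = g i (rp x i u).
  by have [_ _ E _] := gE i; rewrite -!comp_lfunE E.
have qE i u : rq x' i (g i u) = rq x i u.
  by have [_ _ _ E] := gE i; rewrite -!comp_lfunE E.
have d0 : dimr x 0%N = 0%N by apply: dim_is0 dx _.
apply/(pos_locusP hW _ _ xi0); split.
- by move=> i; rewrite dE.
- apply: (mu_chain hW); first by rewrite dE.
  move=> k u; have [u' <-] := gS k.+1 u.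
  have := chain_rel hW d0 mx (u' : chain x k.+1).
  case: k u u' => [|k] u u' /=.
    by rewrite xE yE qE pE => ->.
  by rewrite xE !yE xE => ->.
- move=> k u u'; have [z <-] := gS k.+1 u; have [z' <-] := gS k.+1 u'.
  move=> E; congr (g _ _); apply: (ix k); move: E.
  by case: k u u' z z' => [|k] u u' z z' /=; rewrite ?qE ?yE // => /gI.
Qed.

(** This makes the set produced by the last reflection closed under isomorphism. *)
Lemma reflection_orbit i x x' x'' : (0 < i)%N -> (forall j, mu x'' j = 0) ->
  reflection i x x' -> same_orbit x' x'' -> reflection i x x''.
Proof.
case: i => // m _ mx'' [g []] gb xyE pqE [ra_inj exE rbS] [abE muE0] [h [hb hE]].
have xE j u : rx x'' j (h j u) = h j.+1 (rx x' j u).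
  by have [E _ _ _] := hE j; rewrite -!comp_lfunE E.
have yE j u : ry x'' j (h j.+1 u) = h j (ry x' j u).
  by have [_ E _ _] := hE j; rewrite -!comp_lfunE E.
have pE j u : rp x'' j u = h j (rp x' j u).
  by have [_ _ E _] := hE j; rewrite -!comp_lfunE E.
have qE j u : rq x'' j (h j u) = rq x' j u.
  by have [_ _ _ E] := hE j; rewrite -!comp_lfunE E.
pose hU (u : U x' m.+1) : U x'' m.+1 := (u.1.1, h m u.1.2, h m.+2 u.2).
have hS j u : exists u', h j u' = u by have /lbijP[_] := hb j.
have hI j : injective (h j) by have /lbijP[] := hb j.
have hU_inj : injective hU.
  by case=> [[a b] c] [[a' b'] c'] [-> /hI -> /hI ->].
have raE u : ra (h m.+1 u) = hU (ra u) by rewrite /ra /hU /= qE yE xE.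
have rbE u : rb (hU u) = h m.+1 (rb u).
  by rewrite /rb /hU /= pE xE yE linearB linearD.
exists (fun j => h j \o g j)%VF; split.
- by move=> j nej; apply: lbij_comp => //; apply: gb.
- move=> j nej nej1; have [xgE ygE] := xyE j nej nej1.
  split; apply/lfunP => u; rewrite !comp_lfunE ?xE ?yE.
    by rewrite -[rx x' j _]comp_lfunE xgE comp_lfunE.
  by rewrite -[ry x' j _]comp_lfunE ygE comp_lfunE.
- move=> j nej; have [pgE qgE] := pqE j nej.
  split; apply/lfunP => u; rewrite !comp_lfunE ?pE ?qE.
    by rewrite pgE comp_lfunE.
  by rewrite -[LHS]comp_lfunE qgE.
- split=> //.
  + move=> u u'; have [z <-] := hS _ u; have [z' <-] := hS _ u'.
    by rewrite !raE => /hU_inj/ra_inj ->.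
  + move=> u; rewrite exE; split=> -[u' u'E].
      by exists (h m.+1 u'); rewrite raE u'E /hU /= !comp_lfunE.
    have [z zE] := hS _ u'; exists z; apply: hU_inj.
    by rewrite -raE zE u'E /hU /= !comp_lfunE.
split; last by move=> j nej; split=> //; case: (muE0 j nej).
move=> u; have := congr1 hU (abE u); rewrite -raE -rbE.
by rewrite /hU /= !comp_lfunE.
Qed.

Lemma reduced_weyl_neg n xi (theta : nat -> int) r i s :
  (forall j, (0 < j)%N -> xi j = theta j.-1 - theta j) ->
  (forall a b, (a < b <= n)%N -> theta a < theta b) ->
  reduced_word n (r ++ i :: s) -> weyl s xi i < 0.
Proof.
move=> xiE theta_incr red; have asc := reduced_ascent red.
have [alls _] := red; move: alls; rewrite all_cat => /andP[_ /andP[vi alls]].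
have /andP[i0 lein] := vi.
by rewrite (weyl_wperm alls xiE) // subr_lt0 theta_incr // asc /= (wperm_le alls).
Qed.

(** The prefix [r] holds the letters still to be applied, so that reducedness of the whole word is
    available at every step of the induction. *)
Lemma reflS_word_spec n (xi theta : nat -> int) v (X : set (rep W)) r s :
  (forall j, (0 < j)%N -> xi j = theta j.-1 - theta j) ->
  (forall a b, (a < b <= n)%N -> theta a < theta b) ->
  X `<=` semistable_locus n xi v -> reduced_word n (r ++ s) ->
  (X !=set0 -> reflS_word n s xi v X !=set0) /\
  forall x', reflS_word n s xi v X x' -> exists2 x, X x &
    [/\ semistable_locus n (weyl s xi) (wstar n (fun i => \dim {:W i}) s v) x',
        (cy x' 0 \o cx x' 0)%VF = (cy x 0 \o cx x 0)%VF &
        forall J : nat -> bool, (forall a b, (a <= b)%N -> J a -> J b) ->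
          forall w, zigzag x J w <-> zigzag x' (J \o wperm s) w].
Proof.
move=> xiE theta_incr XM; elim: s r => [|i s IHs] r red.
  by split=> // x' Xx'; exists x' => //; split=> //; apply: XM.
have [alls _] := red; move: alls; rewrite all_cat => /andP[_ /andP[vi alls]].
have i0 : (0 < i)%N by case/andP: vi.
have neg := reduced_weyl_neg xiE theta_incr red.
have [] := IHs (rcons r i); first by rewrite cat_rcons.
move=> nonempty spec; split.
  move=> /nonempty[x xs]; have [_ _ [xM _ _]] := spec x xs.
  have [x' [x'M xx']] := reflection_exists vi neg xM.
  by exists x'; split=> //; exists x => //; left.
(* The branch of [reflS] for a positive weight never occurs. *)
move=> x' [x'M [y ys [[_ refl]|[pos _]]]]; last first.
  by have := lt_trans neg pos; rewrite ltxx.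
have [x Xx [yM qpE zE]] := spec y ys.
exists x => //; split=> //.
  by rewrite (reflection_qp hW i0 (locus_dim0 yM) (locus_dim0 x'M) refl).
move=> J Jup w; rewrite zE //.
rewrite (reflection_zigzag hW _ i0 (locus_dim0 yM) (locus_dim0 x'M) refl) //=.
by apply: Jup; apply/ltnW/(reduced_ascent red).
Qed.

Variable B : forall i, {biscalar (W i)}.
Hypothesis hB : forall i, nondeg (B i).

Lemma sigma_spec n xi v s x : (0 < n)%N ->
  (forall i, vert n i -> 0 < xi i) ->
  (forall i, vert n i -> xi (n.+1 - i)%N = xi i) ->
  longest_word n s -> semistable_locus n xi v x ->
  exists x', [/\ sigma B n s xi v (Gorbit x) = Gorbit x',
    semistable_locus n xi (wstar n (fun i => \dim {:W i}) s v) x' &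
    phi_rep n x' = sigma1 (B 1%N) (phi_rep n x)].
Proof.
move=> n0 xi0 xi_sym ls xM.
have [theta thetaE] := weight_diff (fun i => - xi i).
have theta_incr a b : (a < b <= n)%N -> theta a < theta b.
  case/andP=> /subnK <-; elim: (b - a.+1)%N => [|l IHl] leln.
    rewrite add0n -subr_lt0; have := thetaE a.+1 isT => /= <-.
    by rewrite oppr_lt0 xi0 // /vert; lia.
  apply: lt_trans (IHl (ltnW leln)) _.
  rewrite addSn -subr_lt0; have := thetaE (l + a.+1).+1 isT => /= <-.
  by rewrite oppr_lt0 xi0 // /vert; lia.
have [red _] := ls; have [alls _] := red.
(* The longest element reverses [theta], hence sends [-xi] to the reversal of [xi], which is [xi] by
   symmetry. *)
have weylE i : vert n i -> weyl s (fun i => - xi i) i = xi i.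
  move=> vi; have /andP[i0 lein] := vi.
  rewrite (weyl_wperm alls thetaE) // !(longest_wperm ls) //; last by lia.
  have := thetaE (n.+1 - i)%N; rewrite xi_sym //.
  have -> : (n.+1 - i).-1 = (n - i)%N by lia.
  have -> : (n.+1 - i)%N = (n - i.-1)%N by lia.
  by lia.
have sub : tau B (Gorbit x) `<=` semistable_locus n (fun i => - xi i) v.
  move=> _ [z xz [BV nBV ->]]; apply: transpose_locus => //.
  exact: pos_locus_orbit xM xz.
have [nonempty spec] := reflS_word_spec (r := [::]) thetaE theta_incr sub red.
have spec' y : sigma B n s xi v (Gorbit x) y ->
    semistable_locus n xi (wstar n (fun i => \dim {:W i}) s v) y /\
    phi_rep n y = sigma1 (B 1%N) (phi_rep n x).
  case/spec => _ [z xz [BV nBV ->]] [yM qpE zE].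
  rewrite (eq_locus _ weylE) in yM; split=> //.
  have [dy my iy] := (pos_locusP hW _ _ xi0).1 yM.
  have dy0 i : ~~ vert n i -> dimr y i = 0%N by apply: dim_is0 dy.
  have [dz _ _] := pos_locus_orbit xi0 xM xz.
  have dz0 i : ~~ vert n i -> dimr z i = 0%N by apply: dim_is0 dz.
  rewrite -(phi_rep_orbit n xz) !phi_repE /sigma1 /= qpE transpose_qp //.
  congr (_, _); apply/ffunP => m; rewrite !ffunE; apply/vspaceP => w.
  have lem : (m <= n.+1)%N by rewrite -ltnS.
  pose J k := (n.+1 - m <= k)%N.
  have JE k : (k <= n)%N -> (J \o wperm s) k = (k < m)%N.
    by move=> lekn; rewrite /= (longest_wperm ls) // /J; lia.
  have Jup a b : (a <= b)%N -> J a -> J b by move=> leab /leq_trans; apply.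
  have posE := zigzag_pos hW w dy0 my iy lem JE.
  have negE := @zigzag_neg _ _ n (transpose B BV) J (n.+1 - m) w dz0
    (leq_subr _ _) (fun=> erefl).
  have perpE := transpose_cxpath0 hB nBV (n.+1 - m) w.
  rewrite /= subSS; apply/idP/idP.
    by move/posE/(zE _ Jup)/negE/perpE.
  by move/perpE/negE/(zE _ Jup)/posE.
have [|x' x's] := nonempty.
  pose BV i : {biscalar (gr C (dimr x) i)} := @dotform C (dimr x i).
  exists (transpose B BV); exists x; first exact: same_orbit_refl.
  by exists BV => // i; apply: dotform_nondeg.
have [x'M x'E] := spec' x' x's; exists x'; split=> //.
have [dx' mx' ix'] := (pos_locusP hW _ _ xi0).1 x'M.
apply/seteqP; split=> y.
  move=> /spec'[yM yE]; have [dy my iy] := (pos_locusP hW _ _ xi0).1 yM.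
  apply: (phi_rep_inj hW (n := n)) => //; last by rewrite x'E.
    by move=> i; apply: dim_is0 dx'.
  by move=> i; apply: dim_is0 dy.
(* The word is not empty, because its permutation sends 0 to [n > 0]. So there is a last reflection,
   and it may be followed by an isomorphism. *)
move=> x'y; have yM := pos_locus_orbit xi0 x'M x'y.
move: (longest_wperm ls (leq0n n)) weylE x's.
rewrite subn0 /sigma; case: (s) alls yM red => [|i s'] /=; first by lia.
move=> /andP[/andP[i0 _] _] yM red _ weylE [_ [z zs [[neg refl]|[pos _]]]].
  split; first by rewrite (eq_locus _ weylE).
  have [_ my _] := yM.
  by exists z => //; left; split=> //; apply: reflection_orbit refl x'y.
have neg := reduced_weyl_neg (r := [::]) thetaE theta_incr red.
by have := lt_trans neg pos; rewrite ltxx.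
Qed.

End Orbits.

Theorem theorem6p2p1 (R : realType) (n : nat) (hn : (0 < n)%N)
    (xi : nat -> int)
    (hxi : forall i, vert n i -> 0 < xi i)
    (hxi_sym : forall i, vert n i -> xi (n.+1 - i)%N = xi i)
    (W : nat -> vectType R[i])
    (hW : forall i, i <> 1%N -> \dim {:W i} = 0%N)
    (B : forall i, {biscalar (W i)})
    (hB : forall i, nondeg (B i))
    (v : nat -> int)
    (hv1 : v 1%N <= (\dim {:W 1%N})%:Z)
    (hv : forall i, (1 <= i < n)%N -> v i.+1 <= v i)
    (hvn : 0 <= v n)
    (s : seq nat) (hs : longest_word n s) :
  let w i := \dim {:W i} in
  let w0v := wstar n w s v in
  let M := Nakajima W n xi v in
  let M' := Nakajima W n xi w0v in
  let sg := sigma B n s xi v in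
  [/\ set_bij M (Tflagvar (W 1%N) n v) (phi n) /\
      set_bij M' (Tflagvar (W 1%N) n w0v) (phi n),
      set_bij M M' sg,
      forall X, M X -> phi n (sg X) = sigma1 (B 1%N) (phi n X),
      (forall i, vert n i -> w0v i = v i) <->
      (forall i, vert n i -> v i + v (n.+1 - i)%N = (w 1%N)%:Z) &
      (forall i, vert n i -> w0v i = v i) ->
      set_bij (M `&` [set X | sg X = X]) (Tflagvar_sigma n (B 1%N) v) (phi n)].
Proof.
move=> w w0v M M' sg.
have w0vE i : vert n i -> w0v i = (w 1%N)%:Z - v (n.+1 - i)%N.
  by move=> vi; apply: wstar_longest.
have bijM : set_bij M (Tflagvar (W 1%N) n v) (phi n) by apply: phi_set_bij.
have bijM' : set_bij M' (Tflagvar (W 1%N) n w0v) (phi n) by apply: phi_set_bij.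
have [Mmap Minj Msurj] := bijM; have [M'map M'inj M'surj] := bijM'.
have sgM X : M X -> M' (sg X) /\ phi n (sg X) = sigma1 (B 1%N) (phi n X).
  case=> x xM <-.
  have [x' [sgE x'M x'E]] := sigma_spec hW hB hn hxi hxi_sym hs xM.
  by rewrite /sg sgE !phi_Gorbit x'E; split=> //; exists x'.
split=> //.
- split.
  + by move=> X /sgM[].
  + move=> X Y; rewrite !inE => XM YM E; apply: Minj; rewrite ?inE //.
    apply: (can_inj (sigma1K (hB 1%N))).
    by rewrite -(sgM X XM).2 -(sgM Y YM).2 E.
  (* The preimage is found on the side of flags: the inverse of [sigma1] returns to the dimensions
     [v], since reversing and complementing them twice changes nothing. *)
  + move=> Y YM; have := M'map Y YM.
    move/(sigma1_Tflagvar (flip_nondeg (hB 1%N))).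
    rewrite (@eq_Tflagvar _ _ _ _ v) => [/Msurj[X XM XE]|i vi]; last first.
      have vi' : vert n (n.+1 - i) by move: vi; rewrite /vert; lia.
      rewrite w0vE //; have -> : (n.+1 - (n.+1 - i))%N = i.
        by move: vi; rewrite /vert; lia.
      by rewrite subKr.
    exists X => //; have [sX sE] := sgM X XM.
    by apply: M'inj; rewrite ?inE // sE XE sigma1VK.
- by move=> X /sgM[].
- split=> E i vi; have := E i vi; rewrite w0vE //.
    by move=> <-; rewrite subrK.
  by move=> <-; rewrite addrK.
move=> fixv.
(* When the two dimension vectors agree on the vertices, [X] also lies in [M'], where [phi] is
   injective. *)
have fixE X : M X -> sg X = X <-> sigma1 (B 1%N) (phi n X) = phi n X.
  move=> XM; have [sX <-] := sgM X XM; split=> [->//|E].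
  have XM' : M' X.
    have [x [dx mx ss] <-] := XM; exists x => //; split=> // i.
    by rewrite dx; case: ifP => // vi; rewrite fixv.
  by apply: M'inj; rewrite ?inE.
split.
- move=> X [XM /(fixE X XM)]; have [[F0 Fn FS Fdim] XF] := Mmap X XM.
  case: (phi n X) F0 Fn FS Fdim XF => Y F /= F0 Fn FS Fdim XF [YE FE].
  by split; rewrite /gform /= ?YE //; split=> //=; rewrite FE.
- move=> X Y; rewrite !inE => -[XM _] [YM _].
  by apply: Minj; rewrite inE.
- move=> [Y F] [/= gY [FM FE] YF].
  have [|X XM XE] := Msurj (Y, F); first by split.
  exists X => //; split=> //; apply/(fixE X XM); rewrite XE.
  by rewrite /sigma1 /= -gY -FE.
Qed.
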